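(* Suppose that $\mathbf{X}\in\mathbb{R}^{N\times p}$ has no zero column and that $\Psi\in\Gamma_0(\mathbb{R}^p)$ is Gâteaux differentiable with Lipschitzian gradient $\nabla\Psi$ over $\mathbb{R}^p$. Then, for each $j=1,2,\ldots,2p$, with the operator $\mathbf{T}_{\rm DRS_I}^{(j,q)}:\mathbb{R}^p\times\mathbb{R}^{N+1}\to\mathbb{R}^p\times\mathbb{R}^{N+1}$ defined in the context: (a) $\operatorname{Fix}(\mathbf{T}_{\rm DRS_I}^{(j,q)})$ is bounded; (b) $\mathbf{T}_{\rm DRS_I}^{(j,q)}$ can be plugged into the hybrid steepest descent method, with any $\alpha\in(0,1)$ and any $(\lambda_{n+1})_{n\in\mathbb{N}}\in\ell_+^2\setminus\ell_+^1$, as $$\begin{aligned}(\mathbf{b}_{n+1/2},\mathbf{c}_{n+1/2})&=(1-\alpha)(\mathbf{b}_n,\mathbf{c}_n)+\alpha\mathbf{T}_{\rm DRS_I}^{(j,q)}(\mathbf{b}_n,\mathbf{c}_n),\\ \mathbf{b}_{n+1}^\star&=\mathbf{b}_{n+1/2}-\mathbf{M}_j^*(\mathbf{I}+\mathbf{M}_j\mathbf{M}_j^* )^{-1}(\mathbf{M}_j\mathbf{b}_{n+1/2}-\mathbf{c}_{n+1/2}),\\ \mathbf{b}_{n+1}&=\mathbf{b}_{n+1/2}-\lambda_{n+1}\bigl(\mathbf{I}-\mathbf{M}_j^*(\mathbf{I}+\mathbf{M}_j\mathbf{M}_j^* )^{-1}\mathbf{M}_j\bigr)\nabla\Psi(\mathbf{b}_{n+1}^\star),\\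 \mathbf{c}_{n+1}&=\mathbf{c}_{n+1/2}-\lambda_{n+1}(\mathbf{I}+\mathbf{M}_j\mathbf{M}_j^* )^{-1}\mathbf{M}_j\nabla\Psi(\mathbf{b}_{n+1}^\star),\end{aligned}$$ and, for any $(\mathbf{b}_0,\mathbf{c}_0)\in\mathbb{R}^p\times\mathbb{R}^{N+1}$, this algorithm generates a sequence $(\mathbf{b}_{n+1}^\star)_{n\in\mathbb{N}}\subset\mathbb{R}^p$ which satisfies $\lim_{n\to\infty}d_{\Omega_{\rm DRS_I}^{(j,q)}}(\mathbf{b}_n^\star)=0$, where $\Omega_{\rm DRS_I}^{(j,q)}:=\operatorname{argmin}_{\mathbf{b}^\star\in\mathcal{S}_{(j,q)}}\Psi(\mathbf{b}^\star)\neq\varnothing$ and $\mathcal{S}_{(j,q)}:=\operatorname{argmin}_{\mathbf{b}\in\mathbb{R}^p}\left[g_{(j,q)}(\mathbf{M}_j\mathbf{b})+\|\mathbf{b}\|_1\right]$.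
   Context: Fix $q>1$, $\beta>0$, $\mathbf{z}\in\mathbb{R}^N$ and a matrix $\mathbf{X}\in\mathbb{R}^{N\times p}$ with columns $\mathbf{X}_{:1},\ldots,\mathbf{X}_{:p}$. Put $\mathbf{x}_j=\mathbf{X}_{:j}$ for $j=1,\ldots,p$ and $\mathbf{x}_j=-\mathbf{X}_{:j-p}$ for $j=p+1,\ldots,2p$. Identify $\mathbb{R}\times\mathbb{R}^N$ with $\mathbb{R}^{N+1}$. For $j=1,\ldots,2p$ define the proper lower semicontinuous convex function $g_{(j,q)}:\mathbb{R}\times\mathbb{R}^N\to(-\infty,\infty]$ by $$g_{(j,q)}(\eta,\mathbf{y})=\begin{cases}\dfrac{\|\mathbf{y}-\mathbf{z}\|^q}{\beta(\eta-\mathbf{x}_j^\top\mathbf{z})^{q-1}}&\text{if }\eta>\mathbf{x}_j^\top\mathbf{z},\\ 0&\text{if }\mathbf{y}=\mathbf{z}\text{ and }\eta=\mathbf{x}_j^\top\mathbf{z},\\ +\infty&\text{otherwise,}\end{cases}$$ and the linear operator $\mathbf{M}_j:\mathbb{R}^p\to\mathbb{R}\times\mathbb{R}^N:\mathbf{b}\mapsto(\mathbf{x}_j^\top\mathbf{X}\mathbf{b},\mathbf{X}\mathbf{b})$, with adjoint (transpose) $\mathbf{M}_j^*$. The operator $\mathbf{T}_{\rm DRS_I}^{(j,q)}:(\mathbf{b},\mathbf{c})\mapsto(\mathbf{b}_T,\mathbf{c}_T)$ is defined by $$\begin{aligned}\mathbf{p}&=\mathbf{b}-\mathbf{M}_j^*(\mathbf{I}+\mathbf{M}_j\mathbf{M}_j^*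 )^{-1}(\mathbf{M}_j\mathbf{b}-\mathbf{c}),\\ (\mathbf{b}_{1/2},\mathbf{c}_{1/2})&=(2\mathbf{p}-\mathbf{b},\,2\mathbf{M}_j\mathbf{p}-\mathbf{c}),\\ (\mathbf{b}_T,\mathbf{c}_T)&=(2\operatorname{prox}_{\|\cdot\|_1}(\mathbf{b}_{1/2})-\mathbf{b}_{1/2},\ 2\operatorname{prox}_{g_{(j,q)}}(\mathbf{c}_{1/2})-\mathbf{c}_{1/2}).\end{aligned}$$ Here $\mathbf{I}$ is the identity, $\|\cdot\|$ the Euclidean norm, $\|\cdot\|_1$ the $\ell_1$ norm, and $\operatorname{prox}_f(x)=\operatorname{argmin}_y f(y)+\frac12\|x-y\|^2$. $\Gamma_0(\mathbb{R}^p)$ is the set of proper lower semicontinuous convex functions $\mathbb{R}^p\to(-\infty,\infty]$. $\operatorname{Fix}(T)=\{z:T(z)=z\}$. $d_\Omega(x)=\min_{y\in\Omega}\|x-y\|$. $\ell_+^1$ (resp. $\ell_+^2$) is the set of summable (resp. square-summable) nonnegative real sequences. The hybrid steepest descent method for minimizing a Gâteaux differentiable convex function $\Theta$ over $\operatorname{Fix}(T)$, with $T$ nonexpansive (i.e. $1$-Lipschitz), is the iteration $z_{n+1}=T(z_n)-\lambda_{n+1}\nabla\Theta(T(z_n))$; the algorithm in (b) is this iteration for the operator $(1-\alpha)\mathbf{I}+\alpha\mathbf{T}_{\rm DRS_I}^{(j,q)}$ and $\Theta=\Psi\circ\Xi$ with $\Xi(\mathbf{b},\mathbf{c})=\mathbf{b}-\mathbf{M}_j^*(\mathbf{I}+\mathbf{M}_j\mathbf{M}_j^*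 )^{-1}(\mathbf{M}_j\mathbf{b}-\mathbf{c})$. *)

(* Defs.v *)
From HB Require Import structures.
From mathcomp Require Export all_boot all_order all_algebra.
From mathcomp Require Export all_classical all_reals all_analysis.
Export Order.TTheory GRing.Theory Num.Theory numFieldNormedType.Exports.

Set Implicit Arguments.
Unset Strict Implicit.
Unset Printing Implicit Defensive.

Local Open Scope classical_set_scope.
Local Open Scope ring_scope.

(* The library norm of 'cV[R]_n is the max norm, hence the explicit Euclidean
   inner products and norms on R^n and on R^m x R^n. *)
Definition dot (R : realType) (n : nat) (x y : 'cV[R]_n) : R :=
  (x^T *m y) 0 0.

Definition enorm (R : realType) (n : nat) (x : 'cV[R]_n) : R :=
  Num.sqrt (dot x x).

Definition dot2 (R : realType) (m n : nat) (u v : 'cV[R]_m * 'cV[R]_n) : R :=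
  dot u.1 v.1 + dot u.2 v.2.

Definition enorm2 (R : realType) (m n : nat) (u : 'cV[R]_m * 'cV[R]_n) : R :=
  Num.sqrt (dot2 u u).

Definition norm1 (R : realType) (n : nat) (x : 'cV[R]_n) : R :=
  \sum_(i < n) `|x i 0|.

(* The weight t is kept in the open interval to avoid 0 * +oo. *)
Definition convex_ereal (R : realType) (V : lmodType R) (f : V -> \bar R)
    : Prop :=
  forall (x y : V) (t : R), 0 < t < 1 ->
    (f (t *: x + (1 - t) *: y)%R <= t%:E * f x + (1 - t)%:E * f y)%E.

Definition proper (R : realType) (T : Type) (f : T -> \bar R) : Prop :=
  (forall x, -oo < f x)%E /\ exists x, (f x < +oo)%E.

Definition Gamma0 (R : realType) (n : nat) (f : 'cV[R]_n -> \bar R) : Prop :=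
  [/\ proper f, lower_semicontinuous f & convex_ereal f].

(* f is finite and Gateaux differentiable on the whole space, with gradient gf
   for the inner product ip. *)
Definition gateaux_gradient (R : realType) (V : normedModType R)
    (ip : V -> V -> R) (f : V -> \bar R) (gf : V -> V) : Prop :=
  (forall x, f x \is a fin_num) /\
  (forall x v : V, is_derive x v (fun y => fine (f y)) (ip (gf x) v)).

Definition lipschitzian (R : realType) (n : nat) (F : 'cV[R]_n -> 'cV[R]_n)
    : Prop :=
  exists kappa : R, forall x y, enorm (F x - F y) <= kappa * enorm (x - y).

Definition nonexpansive (R : realType) (m n : nat)
    (T : 'cV[R]_m * 'cV[R]_n -> 'cV[R]_m * 'cV[R]_n) : Prop :=
  forall u v, enorm2 (T u - T v) <= enorm2 (u - v).

Definition argmin (R : realType) (T : Type) (D : set T) (f : T -> \bar R)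
    : set T :=
  [set x | D x /\ forall y, D y -> (f x <= f y)%E].

(* "The" minimizer, as a total function: it is the unique element of the argmin
   set whenever f is in Gamma0, and the default value 0 is used only if that
   set is empty. *)
Definition prox (R : realType) (n : nat) (f : 'cV[R]_n -> \bar R)
    (x : 'cV[R]_n) : 'cV[R]_n :=
  xget 0 (argmin setT (fun y => (f y + (2^-1 * enorm (x - y) ^+ 2)%:E)%E)).

(* Only meaningful for nonempty Om (0 by convention if empty); the infimum is a minimum if Om is closed. *)
Definition dist (R : realType) (n : nat) (Om : set 'cV[R]_n) (x : 'cV[R]_n)
    : R :=
  inf [set enorm (x - y) | y in Om].

Definition Fix (T : Type) (F : T -> T) : set T := [set x | F x = x].

Definition ell1_plus (R : realType) : set (nat -> R) :=
  [set u : nat -> R | (forall n, 0 <= u n) /\ cvgn (series u)].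

Definition ell2_plus (R : realType) : set (nat -> R) :=
  [set u : nat -> R | (forall n, 0 <= u n) /\ cvgn (series (fun n => u n ^+ 2))].

Definition hybrid_steepest_descent (R : realType) (V : lmodType R) (T : V -> V)
    (gradTheta : V -> V) (lam : nat -> R) (w : nat -> V) : Prop :=
  forall n, w n.+1 = T (w n) - lam n.+1 *: gradTheta (T (w n)).

(* x_j ranges over the columns of X followed by their opposites. *)
Definition xvec (R : realType) (N p : nat) (X : 'M[R]_(N, p)) (j : 'I_(p + p))
    : 'cV[R]_N :=
  col j (row_mx X (- X)).

(* A pair (eta, y) of R x R^N is the column vector of R^(1 + N) with upper
   block eta and lower block y. *)
Definition gfun (R : realType) (N p : nat) (q beta : R) (z : 'cV[R]_N)
    (X : 'M[R]_(N, p)) (j : 'I_(p + p)) (c : 'cV[R]_(1 + N)) : \bar R :=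
  let eta : R := usubmx c 0 0 in
  let y : 'cV[R]_N := dsubmx c in
  let a : R := dot (xvec X j) z in
  if a < eta then (enorm (y - z) `^ q / (beta * (eta - a) `^ (q - 1)))%:E
  else if (y == z) && (eta == a) then 0%E
  else +oo%E.

Definition Mop (R : realType) (N p : nat) (X : 'M[R]_(N, p)) (j : 'I_(p + p))
    : 'M[R]_(1 + N, p) :=
  col_mx ((xvec X j)^T *m X) X.

Definition resM (R : realType) (m p : nat) (M : 'M[R]_(m, p)) : 'M[R]_m :=
  invmx (1%:M + M *m M^T).

Definition Xi (R : realType) (m p : nat) (M : 'M[R]_(m, p))
    (u : 'cV[R]_p * 'cV[R]_m) : 'cV[R]_p :=
  u.1 - M^T *m resM M *m (M *m u.1 - u.2).

Definition T_DRSI (R : realType) (N p : nat) (q beta : R) (z : 'cV[R]_N)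
    (X : 'M[R]_(N, p)) (j : 'I_(p + p)) (u : 'cV[R]_p * 'cV[R]_(1 + N))
    : 'cV[R]_p * 'cV[R]_(1 + N) :=
  let M := Mop X j in
  let pp := Xi M u in
  let bh := 2 *: pp - u.1 in
  let ch := 2 *: (M *m pp) - u.2 in
  (2 *: prox (fun b => (norm1 b)%:E) bh - bh,
   2 *: prox (gfun q beta z X j) ch - ch).

Definition Ssol (R : realType) (N p : nat) (q beta : R) (z : 'cV[R]_N)
    (X : 'M[R]_(N, p)) (j : 'I_(p + p)) : set 'cV[R]_p :=
  argmin setT
    (fun b => (gfun q beta z X j (Mop X j *m b)%R + (norm1 b)%:E)%E).

Definition Omega (R : realType) (N p : nat) (q beta : R) (z : 'cV[R]_N)
    (X : 'M[R]_(N, p)) (Psi : 'cV[R]_p -> \bar R) (j : 'I_(p + p))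
    : set 'cV[R]_p :=
  argmin (Ssol q beta z X j) Psi.

(* Main.v *)
Require Import Defs.
From mathcomp Require Import zify ring lra.

Set Implicit Arguments.
Unset Strict Implicit.
Unset Printing Implicit Defensive.

Local Open Scope classical_set_scope.
Local Open Scope ring_scope.

(** Write M for M_j, f for the l1 norm, g for g_(j,q) and x for x_j. The pairs
    (v, M v) and (- M^T n, n) give orthogonal coordinates on the product space,
    in which Xi reads off v. In these coordinates (v, n) is a fixed point of the
    Douglas-Rachford operator T exactly when M^T n is a subgradient of f at v
    and - n is a subgradient of g at M v ([Fix_drsP]), that is, when v solves
    the lower level problem and n is a dual multiplier.

    Fixed points are bounded. The part v is bounded because g >= 0 and f is
    coercive, and M^T n is bounded as a subgradient of the l1 norm. This does not
    bound n when M^T has a kernel, but g is positively homogeneous around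
    (x^T z, z), so a subgradient (mu, u) of g satisfies
    mu + <u, w> <= |w|^q / beta for all w. In particular mu <= 0, and mu tends
    to - oo faster than |u| grows; since x is, up to sign, a column of X, the
    bound on M^T (mu, u) prevents this ([subgrad_gfun_bounded]). Here x must be
    nonzero.

    Fixed points exist. The contraction T / (1 + 2 d) has a fixed point for d > 0.
    The estimates above hold for these points uniformly in d
    ([drs_resolvents_bounded]), so a cluster point as d -> 0 is fixed by T. This
    yields a primal solution together with a dual multiplier. A multiplier of one
    solution is a multiplier of all, so the solution set S of the lower level
    problem is the image of Fix T under Xi ([argmin_primalE]), and minimizing
    Psi over S amounts to minimizing the composite Theta of Psi and Xi over
    Fix T.

    Convergence holds for any nonexpansive operator with a bounded nonempty fixed
    point set and any convex Theta with Lipschitz gradient ([hsd_convergence]).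
    Averaging makes the operator strictly attracting, with a uniform gain outside
    a large ball, and this together with the summability of the squared steps
    keeps the iterates bounded ([hsd_bounded]). Then, by compactness, whenever an
    iterate is away from the minimizers of Theta over Fix T, its squared distance
    to them drops by at least a multiple of the step size; the steps are not
    summable, so the distance tends to 0. As Xi is 1-Lipschitz and maps these
    minimizers into Omega, the distance from b*_n to Omega tends to 0. *)

(** * Euclidean geometry from an inner product *)

(** The library norms on column vectors and on pairs are max norms, so the
    Euclidean geometry is developed from the inner product alone. Finite
    dimension enters only through [ip_cluster]: a bounded sequence has a
    cluster point. The two models are R^n and R^m x R^n. *)
Record euclidean (R : realType) (V : lmodType R) (ip : V -> V -> R) : Prop :=
  Euclidean {
    ipC : forall x y, ip x y = ip y x;
    ipDl : forall x y w, ip (x + y) w = ip x w + ip y w;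
    ipZl : forall a x y, ip (a *: x) y = a * ip x y;
    ip_ge0 : forall x, 0 <= ip x x;
    ip_eq0 : forall x, ip x x = 0 -> x = 0;
    ip_cluster : forall (u : nat -> V) (B : R), (forall n, ip (u n) (u n) <= B) ->
      exists w, forall e : R, 0 < e -> forall n0, exists2 n, (n0 <= n)%N &
        ip (u n - w) (u n - w) < e }.

Definition nrm (R : realType) (V : lmodType R) (ip : V -> V -> R) (x : V) : R :=
  Num.sqrt (ip x x).

Section Geometry.
Variables (R : realType) (V : lmodType R) (ip : V -> V -> R).
Hypothesis E : euclidean ip.
Local Notation N := (nrm ip).
Implicit Types (x y w : V) (a : R).

Lemma ipDr x y w : ip w (x + y) = ip w x + ip w y.
Proof. by rewrite ipC// ipDl// ![ip _ w]ipC. Qed.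

Lemma ipZr a x y : ip x (a *: y) = a * ip x y.
Proof. by rewrite ipC// ipZl// [ip y _]ipC. Qed.

Lemma ipNl x y : ip (- x) y = - ip x y.
Proof. by rewrite -scaleN1r ipZl// mulN1r. Qed.

Lemma ipNr x y : ip x (- y) = - ip x y.
Proof. by rewrite ipC// ipNl [ip y _]ipC. Qed.

Lemma ip0l x : ip 0 x = 0.
Proof. by rewrite -(scale0r x) ipZl// mul0r. Qed.

Definition ipE := (ipDl E, ipDr, ipZl E, ipZr, ipNl, ipNr).

Lemma nrm_ge0 x : 0 <= N x. Proof. exact: sqrtr_ge0. Qed.

Lemma nrm_sqr x : N x ^+ 2 = ip x x.
Proof. by rewrite sqr_sqrtr// ip_ge0. Qed.

Lemma nrm0 : N 0 = 0. Proof. by rewrite /nrm ip0l sqrtr0. Qed.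

Lemma nrm_eq0 x : N x = 0 -> x = 0.
Proof. by move=> h; apply: (ip_eq0 E); rewrite -nrm_sqr h expr0n. Qed.

Lemma nrmZ a x : N (a *: x) = `|a| * N x.
Proof. by rewrite /nrm !ipE mulrA sqrtrM -?expr2 ?sqr_ge0// sqrtr_sqr. Qed.

Lemma nrmN x : N (- x) = N x.
Proof. by rewrite -scaleN1r nrmZ normrN1 mul1r. Qed.

Lemma nrmBC x y : N (x - y) = N (y - x).
Proof. by rewrite -nrmN opprB. Qed.

Lemma nrm_sqrD x y : N (x + y) ^+ 2 = N x ^+ 2 + 2 * ip x y + N y ^+ 2.
Proof. by rewrite !nrm_sqr !ipE (ipC E y x); ring. Qed.

Lemma nrm_sqrB x y : N (x - y) ^+ 2 = N x ^+ 2 - 2 * ip x y + N y ^+ 2.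
Proof. by rewrite nrm_sqrD nrmN ipNr; ring. Qed.

Lemma nrm_le_sqr x a : 0 <= a -> (N x <= a) = (N x ^+ 2 <= a ^+ 2).
Proof. by move=> a0; rewrite ler_sqr// nnegrE nrm_ge0. Qed.

(** Cauchy-Schwarz, from the nonnegativity of the squared norm of
    |y| x - |x| y, which equals 2 |x| |y| (|x| |y| - <x, y>). *)
Lemma ip_le x y : ip x y <= N x * N y.
Proof.
have [y0|y0] := eqVneq (N y) 0.
  by rewrite (nrm_eq0 y0) ipC// ip0l nrm0 mulr0.
have yp : 0 < N y by rewrite lt_def y0 nrm_ge0.
have [x0|x0] := eqVneq (N x) 0.
  by rewrite (nrm_eq0 x0) ip0l nrm0 mul0r.
have xp : 0 < N x by rewrite lt_def x0 nrm_ge0.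
have := sqr_ge0 (N (N y *: x - N x *: y)).
rewrite nrm_sqrB !nrmZ !ipE !ger0_norm ?nrm_ge0// => h.
have xyp : 0 < N x * N y by rewrite mulr_gt0.
have : 0 <= 2 * ((N x * N y) * (N x * N y - ip x y)).
  by apply: le_trans h _; rewrite le_eqVlt; apply/orP; left; apply/eqP; ring.
by rewrite pmulr_rge0// pmulr_rge0// subr_ge0.
Qed.

Lemma ip_abs_le x y : `|ip x y| <= N x * N y.
Proof.
by rewrite ler_norml ip_le andbT lerNl -ipNl (le_trans (ip_le _ _))// nrmN.
Qed.

Lemma nrmD x y : N (x + y) <= N x + N y.
Proof.
rewrite nrm_le_sqr ?addr_ge0 ?nrm_ge0// nrm_sqrD sqrrD.
have := ip_le x y; lra.
Qed.

Lemma nrm_tri w x y : N (x - y) <= N (x - w) + N (w - y).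
Proof. by apply: le_trans (nrmD _ _); rewrite addrA subrK. Qed.

Lemma nrm_dist x y : `|N x - N y| <= N (x - y).
Proof.
have h u v : N u - N v <= N (u - v).
  by rewrite lerBlDr; apply: le_trans (nrmD _ _); rewrite subrK.
by rewrite ler_norml h andbT lerNl opprB nrmBC h.
Qed.

Lemma nrm_cluster (u : nat -> V) B : (forall n, N (u n) <= B) ->
  exists w, forall e : R, 0 < e ->
    forall n0, exists2 n, (n0 <= n)%N & N (u n - w) < e.
Proof.
move=> uB; have /(ip_cluster E)[w hw] : forall n, ip (u n) (u n) <= B ^+ 2.
  move=> n; rewrite -nrm_sqr -nrm_le_sqr//.
  exact: le_trans (nrm_ge0 (u 0%N)) (uB _).
exists w => e e0 n0; have [n n0n h] := hw (e ^+ 2) (exprn_gt0 _ e0) n0.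
exists n => //; move: h; rewrite -nrm_sqr ltr_sqr// nnegrE ?nrm_ge0//.
exact: ltW.
Qed.

(** Continuity, lower semicontinuity and closedness for the norm [N]. They are
    spelled out with balls of [N] because no topology is attached to [V]. *)
Definition econt (h : V -> R) := forall x (e : R), 0 < e ->
  exists2 d : R, 0 < d & forall y, N (y - x) < d -> `|h y - h x| < e.

Definition elsc (f : V -> \bar R) := forall x (a : R), (a%:E < f x)%E ->
  exists2 d : R, 0 < d & forall y, N (y - x) < d -> (a%:E < f y)%E.

Definition eclosed (K : set V) := forall x, ~ K x ->
  exists2 d : R, 0 < d & forall y, N (y - x) < d -> ~ K y.

(** Direct method: a cluster point of a minimizing sequence is a minimizer.
    The sublevel set at height r0 + 1 suffices for boundedness because the
    n-th term of the sequence is within 1/(n+1) of the infimum. *)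
Lemma lsc_argmin (f : V -> \bar R) x0 (r0 m B : R) : elsc f ->
  (f x0 <= r0%:E)%E -> (forall x, m%:E <= f x)%E ->
  (forall x, (f x <= (r0 + 1)%:E)%E -> N x <= B) ->
  exists x, forall y, (f x <= f y)%E.
Proof.
move=> fl fx0 fm fB; pose A := [set r : R | exists x, (f x <= r%:E)%E].
have Ar0 : A r0 by exists x0.
have lA : lbound A m.
  by move=> r [x fx]; rewrite -lee_fin (le_trans (fm x)).
have iA : has_inf A by split; [exists r0|exists m].
pose mu := inf A.
have hmu : mu <= r0 by apply: ge_inf => //; exists m.
have seqx n : exists x, (f x <= (mu + n.+1%:R^-1)%:E)%E.
  have n0 : 0 < n.+1%:R^-1 :> R by rewrite invr_gt0.
  have [r [x fx] rlt] := inf_adherent n0 iA.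
  by exists x; apply: le_trans fx _; rewrite lee_fin ltW.
have [u hu] := choice seqx.
have /nrm_cluster[w hw] : forall n, N (u n) <= B.
  move=> n; apply: fB; apply: le_trans (hu n) _.
  rewrite lee_fin lerD// invf_le1// ler1n//.
have fw : (f w <= mu%:E)%E.
  rewrite leNgt; apply/negP => fw.
  have [a aw amu] : exists2 a : R, (a%:E < f w)%E & mu < a.
    case: (f w) fw => [r| |] //= fw.
      rewrite lte_fin in fw; exists ((mu + r) / 2); rewrite ?lte_fin; lra.
    by exists (mu + 1); rewrite ?ltry//; lra.
  have [d d0 hd] := fl _ _ aw.
  (* from some rank on, the values of f along u are below a *)
  have [n0 hn0] : exists n0 : nat, forall n, (n0 <= n)%N -> mu + n.+1%:R^-1 < a.
    exists (Num.truncn (a - mu)^-1) => n hn.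
    rewrite -ltrBrDl invf_plt ?posrE ?subr_gt0//.
    apply: lt_le_trans (truncnS_gt _) _.
    by rewrite ler_nat ltnS.
  have [n n0n hn] := hw d d0 n0.
  have := hd _ hn; rewrite ltNge => /negP; apply.
  by rewrite (le_trans (hu n))// lee_fin ltW// hn0.
exists w => y; case fy: (f y) => [r| |]; last 2 first.
- by rewrite leey.
- by have := fm y; rewrite fy.
apply: le_trans fw _; rewrite lee_fin; apply: ge_inf; first by exists m.
by exists y; rewrite fy.
Qed.

Lemma econt_lip (h : V -> R) (L : R) :
  (forall x y, `|h y - h x| <= L * N (y - x)) -> econt h.
Proof.
move=> hL x e e0; exists (e / (`|L| + 1)).
  by rewrite divr_gt0// ltr_wpDl.
move=> y hy; apply: le_lt_trans (hL _ _) _.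
rewrite ltr_pdivlMr ?ltr_wpDl// in hy.
have := nrm_ge0 (y - x); have := ler_norm L; nra.
Qed.

Lemma econt_nrm w : econt (fun x => N (x - w)).
Proof.
apply: (@econt_lip _ 1) => x y; rewrite mul1r (le_trans (nrm_dist _ _))//.
by rewrite opprB addrA subrK.
Qed.

Lemma econt_nrmB w : econt (fun x => - N (x - w)).
Proof.
move=> x e e0; have [d d0 hd] := econt_nrm w x e0; exists d => // y /hd.
by rewrite -opprD normrN.
Qed.

Lemma eclosed_le (h : V -> R) c : econt h -> eclosed [set x | h x <= c].
Proof.
move=> hc x /= /negP; rewrite -ltNge => cx.
have /(hc x)[d d0 hd] : 0 < h x - c by rewrite subr_gt0.
exists d => // y /hd; rewrite ltr_norml => /andP[h1 _]; apply/negP.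
rewrite -ltNge; lra.
Qed.

Lemma eclosedI K1 K2 : eclosed K1 -> eclosed K2 -> eclosed (K1 `&` K2).
Proof.
move=> c1 c2 x /not_andP[/c1|/c2] [d d0 hd]; exists d => // y /hd h [] //.
Qed.

(** Reduction to [lsc_argmin] by giving h the value +oo outside K: closedness
    of K makes this extension lower semicontinuous. *)
Lemma closed_argmin (K : set V) (h : V -> R) (B m : R) :
  eclosed K -> econt h -> K !=set0 -> (forall x, K x -> N x <= B) ->
  (forall x, K x -> m <= h x) ->
  exists2 x, K x & forall y, K y -> h x <= h y.
Proof.
move=> Kc hc [x0 Kx0] KB hm.
pose f x := if `[< K x >] then (h x)%:E else +oo%E.
have fK x : K x -> f x = (h x)%:E by rewrite /f; case: asboolP.
have fN x : ~ K x -> f x = +oo%E by rewrite /f; case: asboolP.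
have [|||x|x hx] := @lsc_argmin f x0 (h x0) m B.
- move=> x a; have [Kx|Kx] := pselect (K x).
    rewrite fK// lte_fin -subr_gt0 => /(hc x)[d d0 hd].
    exists d => // y /hd; rewrite ltr_norml => /andP[h1 _].
    have [Ky|Ky] := pselect (K y); last by rewrite fN// ltry.
    by rewrite fK// lte_fin; lra.
  by have [d d0 hd] := Kc _ Kx => _; exists d => // y /hd/fN ->; rewrite ltry.
- by rewrite fK.
- move=> x; have [Kx|Kx] := pselect (K x); last by rewrite fN// leey.
  by rewrite fK// lee_fin hm.
- have [Kx|Kx] := pselect (K x); first by move=> _; exact: KB.
  by rewrite fN// leye_eq.
have Kx : K x.
  apply: contrapT => Kx; have := hx x0; rewrite fN// fK//.
by exists x => // y Ky; have := hx y; rewrite !fK// lee_fin.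
Qed.

(** The form in which compactness is used below: strict positivity on a
    bounded closed set is uniform. *)
Lemma closed_pos (K : set V) (h : V -> R) (B : R) :
  eclosed K -> econt h -> (forall x, K x -> N x <= B) ->
  (forall x, K x -> 0 < h x) ->
  exists2 rho : R, 0 < rho & forall x, K x -> rho <= h x.
Proof.
move=> Kc hc KB h0; have [K0|K0] := pselect (K !=set0); last first.
  by exists 1 => // x Kx; exfalso; apply: K0; exists x.
have [x Kx hx] := closed_argmin Kc hc K0 KB (fun x Kx => ltW (h0 x Kx)).
by exists (h x) => //; exact: h0.
Qed.

End Geometry.

(** * Two recursive inequalities for real sequences *)
Section RealSequences.
Variable R : realType.
Implicit Types (a d lam : nat -> R).

(** The maximum of a n and r is multiplied at step n by at most
    1 + k (lam n)^2 <= exp (k (lam n)^2), and the product of these factors is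
    bounded because the squares of lam are summable. *)
Lemma bounded_of_growth a lam (k r S : R) n1 :
  0 <= k -> 0 <= r -> (forall n, \sum_(0 <= i < n) lam i ^+ 2 <= S) ->
  (forall n, (n1 <= n)%N -> a n.+1 <= (1 + k * lam n ^+ 2) * Num.max (a n) r) ->
  exists B, forall n, (n1 <= n)%N -> a n <= B.
Proof.
move=> k0 r0 hS ha; pose b n := Num.max (a n) r.
have b0 n : 0 <= b n by rewrite /b le_max r0 orbT.
have key n : b (n1 + n)%N <= b n1 * expR (k * \sum_(0 <= i < n1 + n) lam i ^+ 2).
  elim: n => [|n IH].
    rewrite addn0; apply: ler_peMr => //; rewrite -expR0 ler_expR mulr_ge0//.
    by apply: sumr_ge0 => i _; exact: sqr_ge0.
  rewrite addnS big_nat_recr//= mulrDr expRD mulrA.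
  have e1 : 1 <= expR (k * lam (n1 + n)%N ^+ 2).
    by rewrite -expR0 ler_expR mulr_ge0// sqr_ge0.
  have step : b (n1 + n).+1 <= expR (k * lam (n1 + n)%N ^+ 2) * b (n1 + n)%N.
    rewrite {1}/b ge_max; apply/andP; split; last first.
      have rb : r <= b (n1 + n)%N by rewrite /b le_max lexx orbT.
      exact: le_trans rb (ler_peMl (b0 _) e1).
    apply: le_trans (ha _ (leq_addr _ _)) _.
    by rewrite ler_wpM2r ?expR_ge1Dx//; exact: b0.
  by apply: le_trans step _; rewrite mulrC ler_wpM2r// expR_ge0.
exists (b n1 * expR (k * S)) => n hn; rewrite -(subnKC hn).
have ab : a (n1 + (n - n1))%N <= b (n1 + (n - n1))%N by rewrite /b le_max lexx.
apply: le_trans ab (le_trans (key _) _).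
by apply: ler_wpM2l => //; rewrite ler_expR ler_wpM2l.
Qed.

(** As long as d stays above r/2, its square loses a fixed multiple of lam
    at each step; lam is not summable, so d goes below r/2 at some late index.
    From then on d stays below r: it cannot increase while it is above r/2,
    and a single step from below r/2 adds less than r/2. *)
Lemma vanishing_of_descent d lam (c : R) n1 :
  (forall n, 0 <= d n) -> (forall n, 0 <= lam n) -> 0 <= c ->
  (forall n, (n1 <= n)%N -> d n.+1 <= d n + c * lam n) ->
  (forall e : R, 0 < e -> exists n0, forall n, (n0 <= n)%N -> lam n < e) ->
  (forall M, exists n, M < \sum_(0 <= i < n) lam i) ->
  (forall r : R, 0 < r -> exists2 eta : R, 0 < eta &
     exists n0, forall n, (n0 <= n)%N ->
     r <= d n -> d n.+1 ^+ 2 <= d n ^+ 2 - eta * lam n) ->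
  forall r : R, 0 < r -> exists n0, forall n, (n0 <= n)%N -> d n < r.
Proof.
move=> d0 l0 c0 dc lam0 lamS dec r r0.
have r2 : 0 < r / 2 by rewrite divr_gt0.
have [eta eta0 [n2 hn2]] := dec _ r2.
have [|n3 hn3] := lam0 (r / 2 / (c + 1)).
  by rewrite divr_gt0// ltr_wpDl.
pose m := maxn n1 (maxn n2 n3).
have [k hmk hk] : exists2 k, (m <= k)%N & d k < r / 2.
  apply: contrapT => hno.
  have big k : (m <= k)%N -> r / 2 <= d k.
    by move=> mk; rewrite leNgt; apply/negP => dk; apply: hno; exists k.
  have tel k : d (m + k)%N ^+ 2 + eta * \sum_(0 <= i < m + k) lam i <=
               d m ^+ 2 + eta * \sum_(0 <= i < m) lam i.
    elim: k => [|k IH]; first by rewrite addn0.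
    apply: le_trans IH; rewrite addnS big_nat_recr//=.
    have := hn2 (m + k)%N _ (big _ (leq_addr _ _)).
    have -> : (n2 <= m + k)%N.
      by apply: leq_trans (leq_addr _ _); rewrite /m; lia.
    by move=> /(_ erefl); rewrite mulrDr; lra.
  have [n hn] := lamS ((d m ^+ 2 + eta * \sum_(0 <= i < m) lam i) / eta).
  have := tel n; rewrite leNgt => /negP; apply.
  rewrite ltr_pdivrMr// in hn; apply: lt_le_trans hn _.
  have : \sum_(0 <= i < n) lam i <= \sum_(0 <= i < m + n) lam i.
    by rewrite [leRHS](big_cat_nat (n := n))//= ?lerDl ?sumr_ge0 ?leq_addl.
  have := sqr_ge0 (d (m + n)%N); nra.
exists k => n hn; rewrite -(subnKC hn); elim: (n - k)%N => [|i IH].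
  by rewrite addn0; lra.
rewrite addnS; have [di|di] := leP (r / 2) (d (k + i)%N).
  apply: le_lt_trans IH.
  have h : d (k + i).+1 ^+ 2 <= d (k + i)%N ^+ 2 - eta * lam (k + i)%N.
    by apply: hn2 => //; rewrite /m in hmk; lia.
  rewrite -ler_sqr ?nnegrE//; apply: le_trans h _.
  by rewrite gerBl mulr_ge0// ltW.
have h1 : d (k + i).+1 <= d (k + i)%N + c * lam (k + i)%N.
  by apply: dc; rewrite /m in hmk; lia.
have h2 : lam (k + i)%N < r / 2 / (c + 1) by apply: hn3; rewrite /m in hmk; lia.
rewrite ltr_pdivlMr ?ltr_wpDl// in h2.
have := l0 (k + i)%N; nra.
Qed.

Lemma ell2_bounded_vanishing lam : ell2_plus lam ->
  (exists S, forall n, \sum_(0 <= i < n) lam i ^+ 2 <= S) /\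
  (forall e : R, 0 < e -> exists n0, forall n, (n0 <= n)%N -> lam n < e).
Proof.
move=> [l0 cl]; split.
  exists (limn (series (fun n => lam n ^+ 2))) => n.
  apply: (@nondecreasing_cvgn_le _ (series (fun n => lam n ^+ 2))) => //.
  apply: nondecreasing_series => i _ _; exact: sqr_ge0.
move=> e e0; have /cvgrPdist_lt/(_ _ (exprn_gt0 2 e0))[n0 _ h] :=
  cvg_series_cvg_0 cl.
exists n0 => n /h /=; rewrite sub0r normrN ger0_norm ?sqr_ge0// ltr_sqr//.
  by rewrite nnegrE.
by rewrite nnegrE ltW.
Qed.

Lemma non_ell1_unbounded lam : (forall n, 0 <= lam n) -> ~ ell1_plus lam ->
  forall M, exists n, M < \sum_(0 <= i < n) lam i.
Proof.
move=> l0 nl M; apply: contrapT => hno; apply: nl; split => //.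
apply: nondecreasing_is_cvgn; first exact: nondecreasing_series.
exists M => _ [n _ <-]; rewrite leNgt; apply/negP => h.
by apply: hno; exists n.
Qed.

End RealSequences.

(** * Distance to a set *)
Section SetDistance.
Variables (R : realType) (V : lmodType R) (ip : V -> V -> R).
Hypothesis E : euclidean ip.
Local Notation N := (nrm ip).

Definition setdist (K : set V) (x : V) : R := inf [set N (x - y) | y in K].

Variable K : set V.
Hypothesis K0 : K !=set0.

Let lb0 x : lbound [set N (x - y) | y in K] 0.
Proof. by move=> _ [y _ <-]; exact: nrm_ge0. Qed.

Lemma setdist_le x y : K y -> setdist K x <= N (x - y).
Proof. by move=> Ky; apply: ge_inf; [exists 0; exact: lb0 | exists y]. Qed.

Lemma le_setdist x a : (forall y, K y -> a <= N (x - y)) -> a <= setdist K x.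
Proof.
move=> h; apply: lb_le_inf; first by case: K0 => y Ky; exists (N (x - y)), y.
by move=> _ [y Ky <-]; exact: h.
Qed.

Lemma setdist_ge0 x : 0 <= setdist K x.
Proof. by apply: le_setdist => y _; exact: nrm_ge0. Qed.

Lemma setdist_lip x y : setdist K x <= N (x - y) + setdist K y.
Proof.
rewrite -lerBlDl; apply: le_setdist => w Kw; rewrite lerBlDl.
exact: le_trans (setdist_le _ Kw) (nrm_tri E _ _ _).
Qed.

Lemma setdist_contract (A : V -> V) x :
  (forall y, K y -> N (A x - y) <= N (x - y)) -> setdist K (A x) <= setdist K x.
Proof.
move=> h; apply: le_setdist => y Ky; exact: le_trans (setdist_le _ Ky) (h _ Ky).
Qed.

Lemma econt_setdistN : econt ip (fun x => - setdist K x).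
Proof.
apply: (@econt_lip _ _ _ _ 1) => x y; rewrite mul1r ler_norml.
have := setdist_lip x y; have := setdist_lip y x.
rewrite (nrmBC E x y); lra.
Qed.

(** A decrease of the squared distance to each point of K, by an amount that
    does not depend on the point, passes to the infimum; no nearest point has
    to be chosen. *)
Lemma setdist_sqr_le x x' s : 0 <= setdist K x' ^+ 2 + s ->
  (forall y, K y -> N (x' - y) ^+ 2 <= N (x - y) ^+ 2 - s) ->
  setdist K x' ^+ 2 <= setdist K x ^+ 2 - s.
Proof.
move=> s0 h; rewrite lerBrDr -(@sqr_sqrtr _ (_ + s))//.
rewrite ler_sqr ?nnegrE ?sqrtr_ge0 ?setdist_ge0//.
apply: le_setdist => y Ky; rewrite -ler_sqr ?nnegrE ?sqrtr_ge0 ?nrm_ge0//.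
rewrite sqr_sqrtr// -lerBrDr; apply: le_trans (h _ Ky).
by rewrite ler_sqr ?nnegrE ?setdist_ge0 ?nrm_ge0// setdist_le.
Qed.

End SetDistance.

(** * Hybrid steepest descent over a bounded fixed point set *)
Definition averaged (R : realType) (V : lmodType R) (alpha : R) (T : V -> V)
  (x : V) : V := (1 - alpha) *: x + alpha *: T x.

Section HybridSteepestDescent.
Variables (R : realType) (V : lmodType R) (ip : V -> V -> R).
Hypothesis E : euclidean ip.
Local Notation N := (nrm ip).
Variables (T : V -> V) (alpha : R).
Hypothesis Tne : forall x y, N (T x - T y) <= N (x - y).
Hypothesis alpha01 : 0 < alpha < 1.
Local Notation A := (averaged alpha T).
Let c := alpha * (1 - alpha).

Let c_gt0 : 0 < c.
Proof. by case/andP: alpha01 => a0 a1; rewrite mulr_gt0// subr_gt0. Qed.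

Lemma averaged_nonexpansive x y : N (A x - A y) <= N (x - y).
Proof.
case/andP: alpha01 => a0 a1.
have -> : A x - A y = (1 - alpha) *: (x - y) + alpha *: (T x - T y).
  by rewrite /averaged !scalerBr opprD addrACA.
apply: le_trans (nrmD E _ _) _; rewrite !(nrmZ E) !ger0_norm; [|lra..].
have := Tne x y; nra.
Qed.

Lemma averaged_fix x : Fix T x -> A x = x.
Proof. by move=> Tx; rewrite /averaged Tx -scalerDl subrK scale1r. Qed.

(** The gain over nonexpansiveness comes from the identity
    |(1-t) a + t b|^2 = (1-t) |a|^2 + t |b|^2 - t (1-t) |a - b|^2
    with a = x - y and b = T x - y. *)
Lemma averaged_attracting x y : Fix T y ->
  N (A x - y) ^+ 2 <= N (x - y) ^+ 2 - c * N (x - T x) ^+ 2.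
Proof.
case/andP: alpha01 => a0 a1 Ty.
have -> : A x - y = (1 - alpha) *: (x - y) + alpha *: (T x - y).
  rewrite /averaged !scalerBr addrACA -opprD -scalerDl subrK scale1r//.
have -> : x - T x = (x - y) - (T x - y) by rewrite opprB addrA subrK.
have : N (T x - y) ^+ 2 <= N (x - y) ^+ 2.
  by rewrite ler_sqr ?nnegrE ?nrm_ge0// -{1}Ty Tne.
rewrite (nrm_sqrD E (_ *: _)) (nrm_sqrB E (x - y)) !(nrmZ E) (ipZl E) (ipZr E).
rewrite !exprMn !real_normK ?num_real// /c; nra.
Qed.

Lemma econt_residual : econt ip (fun x => N (x - T x)).
Proof.
apply: (@econt_lip _ _ _ _ 2) => y x.
apply: le_trans (nrm_dist E _ _) _.
have -> : x - T x - (y - T y) = (x - y) - (T x - T y).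
  by rewrite !opprB addrACA [RHS]addrACA [- T x - y]addrC.
apply: le_trans (nrmD E _ _) _; rewrite (nrmN E).
have := Tne x y; lra.
Qed.

Lemma eclosed_Fix : eclosed ip (Fix T).
Proof.
have -> : Fix T = [set x | N (x - T x) <= 0].
  apply/seteqP; split => x /= h; first by rewrite {1}h subrr (nrm0 E).
  have /(nrm_eq0 E)/eqP : N (x - T x) = 0 by apply/eqP; rewrite eq_le h nrm_ge0.
  by rewrite subr_eq0 => /eqP.
exact: eclosed_le econt_residual.
Qed.

Variables (B0 : R) (w0 : V).
Hypothesis FixB : forall x, Fix T x -> N x <= B0.
Hypothesis Fw0 : Fix T w0.

(** Away from a large ball, the averaged operator moves points towards w0 by a
    fixed amount. On a sphere around w0 that encloses all fixed points the
    residual |x - T x| is bounded below by compactness, whence the amount D.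
    A point x outside the sphere is compared with its radial projection x':
    nonexpansiveness loses at most |x - x'| = |x - w0| - r. *)
Lemma averaged_shrinking : exists2 r : R, 0 <= r & exists2 D : R, 0 < D &
  forall x, r <= N (x - w0) -> N (A x - w0) <= N (x - w0) - D.
Proof.
pose r := B0 + N w0 + 1.
have r0 : 0 < r.
  have := FixB Fw0; have := nrm_ge0 ip w0; rewrite /r; lra.
exists r; first exact: ltW.
pose K := [set x | N (x - w0) <= r] `&` [set x | - N (x - w0) <= - r].
have KE x : K x -> N (x - w0) = r.
  by move=> [/= h1 h2]; apply/eqP; rewrite eq_le h1/=; lra.
have [||||rho rho0 hrho] := @closed_pos _ _ _ E K (fun x => N (x - T x)) (r + N w0).
- apply: eclosedI; apply: eclosed_le; [exact: econt_nrm|exact: econt_nrmB].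
- exact: econt_residual.
- by move=> x /KE <-; rewrite -{1}(subrK w0 x) (nrmD E).
- move=> x Kx; rewrite lt_def nrm_ge0 andbT; apply/eqP => /(nrm_eq0 E)/eqP.
  rewrite subr_eq0 => /eqP/esym/FixB.
  have := KE _ Kx; have := nrmD E x (- w0); rewrite (nrmN E) /r; lra.
(* (r - D)^2 >= r^2 - 2 r D = r^2 - c rho^2, a bound for |A x - w0|^2 on the
   sphere *)
pose D := c * rho ^+ 2 / (2 * r).
have D0 : 0 < D by apply: divr_gt0; apply: mulr_gt0 => //; exact: exprn_gt0.
have DE : 2 * r * D = c * rho ^+ 2 by rewrite /D mulrC divfK// gt_eqF// mulr_gt0.
have sph x : N (x - w0) = r -> N (A x - w0) <= r - D.
  move=> xr; have Kx : K x by split; rewrite /= xr.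
  have h1 := averaged_attracting x Fw0.
  have h2 : rho ^+ 2 <= N (x - T x) ^+ 2.
    by rewrite ler_sqr ?nnegrE ?nrm_ge0 ?(ltW rho0)// hrho.
  rewrite xr in h1.
  have h3 : c * rho ^+ 2 <= c * N (x - T x) ^+ 2 by rewrite ler_wpM2l// ltW.
  have h4 := sqr_ge0 (N (A x - w0)).
  have h5 : D <= r by nra.
  rewrite nrm_le_sqr ?subr_ge0//; nra.
exists D => // x rx.
have x0 : 0 < N (x - w0) by apply: lt_le_trans rx.
pose t := r / N (x - w0); pose x' := w0 + t *: (x - w0).
have t0 : 0 <= t by rewrite divr_ge0// ltW.
have t1 : t <= 1 by rewrite ler_pdivrMr// mul1r.
have tN : t * N (x - w0) = r by rewrite divfK// gt_eqF.
have x'r : N (x' - w0) = r by rewrite /x' addrC addKr (nrmZ E) ger0_norm.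
have xx' : N (x - x') = N (x - w0) - r.
  have -> : x - x' = (1 - t) *: (x - w0).
    by rewrite /x' opprD addrA scalerBl scale1r.
  by rewrite (nrmZ E) ger0_norm ?subr_ge0// mulrBl mul1r tN.
apply: le_trans (nrm_tri E (A x') _ _) _.
have := averaged_nonexpansive x x'; rewrite xx'; have := sph _ x'r; lra.
Qed.

(* [Gsub] is the gradient inequality of the convex function Th. *)
Variables (Th : V -> R) (G : V -> V) (L : R).
Hypothesis L0 : 0 <= L.
Hypothesis Gsub : forall x y, Th x + ip (G x) (y - x) <= Th y.
Hypothesis Glip : forall x y, N (G x - G y) <= L * N (x - y).

Lemma gradient_nrm_le x y : N (G y) <= N (G x) + L * N (y - x).
Proof.
have := nrmD E (G y - G x) (G x); rewrite subrK; have := Glip y x; lra.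
Qed.

Lemma gradient_monotone x y : ip (G x) (y - x) <= ip (G y) (y - x).
Proof.
have := Gsub x y; have := Gsub y x.
by rewrite -(opprB y x) (ipNr E); lra.
Qed.

Lemma econt_gradient : econt ip Th.
Proof.
move=> x e e0; pose k := N (G x) + L + 1.
have k0 : 0 < k by have := L0; have := nrm_ge0 ip (G x); rewrite /k; lra.
exists (Num.min 1 (e / k)); first by rewrite lt_min ltr01 divr_gt0.
move=> y; rewrite lt_min => /andP[y1]; rewrite ltr_pdivlMr// => yk.
have y0 := nrm_ge0 ip (y - x).
have b1 : N (G y) * N (y - x) <= (k - 1) * N (y - x).
  rewrite ler_wpM2r//; have := ler_piMr L0 (ltW y1).
  by have := gradient_nrm_le x y; rewrite /k; lra.
have b2 : N (G x) * N (y - x) <= (k - 1) * N (y - x).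
  rewrite ler_wpM2r//; have := L0; rewrite /k; lra.
have h1 := Gsub x y; have h2 := Gsub y x.
have h3 := ip_abs_le E (G x) (y - x); have h4 := ip_abs_le E (G y) (x - y).
rewrite (nrmBC E x y) in h4.
rewrite !ler_norml in h3 h4; case/andP: h3 => h3 _; case/andP: h4 => h4 _.
rewrite ltr_norml; apply/andP; split; lra.
Qed.

(** The solution set of the bilevel problem: minimizers of Th over the fixed
    points. *)
Definition minFix := [set x | Fix T x /\ forall y, Fix T y -> Th x <= Th y].

Lemma minFix_nonempty : minFix !=set0.
Proof.
have [||x Fx hx] := @closed_argmin _ _ _ E (Fix T) Th B0
  (Th w0 - N (G w0) * (B0 + N w0)) eclosed_Fix econt_gradient _ FixB.
- by exists w0.
- move=> x Fx; apply: le_trans (Gsub w0 x).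
  rewrite lerD2l; have := ip_abs_le E (G w0) (x - w0).
  rewrite ler_norml => /andP[h _]; apply: le_trans h.
  rewrite lerN2 ler_wpM2l ?nrm_ge0//.
  have := nrmD E x (- w0); rewrite (nrmN E); have := FixB Fx; lra.
by exists x; split.
Qed.

Variables (lam : nat -> R) (z : nat -> V).
Hypothesis lam2 : ell2_plus lam.
Hypothesis lam1 : ~ ell1_plus lam.
Hypothesis hz : forall n, z n.+1 = A (z n) - lam n *: G (A (z n)).

Let lam_ge0 n : 0 <= lam n. Proof. by case: lam2. Qed.

(** Let s = |A z_n - w0|. Monotonicity of G bounds the inner product of
    G (A z_n) with A z_n - w0 below by - g s, where g = |G w0|, and the
    Lipschitz bound gives |G (A z_n)| <= g + L s. Hence
    |z_(n+1) - w0| <= (1 + L^2 lam^2) s + 2 g lam. Far from w0,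
    [averaged_shrinking] compensates the term 2 g lam, which tends to 0; only
    factors 1 + L^2 lam^2 remain, and their product is finite. *)
Lemma hsd_bounded :
  exists B, exists n1, forall n, (n1 <= n)%N -> N (z n - w0) <= B.
Proof.
have [[S hS] lam0] := ell2_bounded_vanishing lam2.
have [r r0 [D D0 hD]] := averaged_shrinking.
pose g := N (G w0); have g0 : 0 <= g by exact: nrm_ge0.
have [|n1 hn1] := lam0 (D / (2 * g + 1)).
  by rewrite divr_gt0//; lra.
have L20 : 0 <= L ^+ 2 by exact: sqr_ge0.
have [|n hn|B hB] := @bounded_of_growth R (fun n => N (z n - w0)) lam (L ^+ 2)
  (r + D) S n1 L20 _ hS; last by exists B, n1.
  by lra.
have := hn1 n hn; rewrite ltr_pdivlMr; last by lra.
move=> hl; have l0 := lam_ge0 n; have lg : 2 * g * lam n <= D by nra.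
set y := A (z n); pose s := N (y - w0); have s0 : 0 <= s by exact: nrm_ge0.
have hs : N (z n.+1 - w0) <= (1 + L ^+ 2 * lam n ^+ 2) * s + 2 * g * lam n.
  have k0 : 0 <= L ^+ 2 * lam n ^+ 2 by rewrite mulr_ge0// sqr_ge0.
  rewrite nrm_le_sqr; last by rewrite addr_ge0 ?mulr_ge0//; lra.
  rewrite hz -/y addrAC (nrm_sqrB E) (nrmZ E) (ger0_norm l0) (ipZr E).
  have h1 : - (g * s) <= ip (y - w0) (G y).
    rewrite (ipC E); apply: le_trans (gradient_monotone w0 y).
    by have := ip_abs_le E (G w0) (y - w0); rewrite ler_norml => /andP[].
  have h2 : N (G y) <= g + L * s by exact: gradient_nrm_le.
  have h3 : (lam n * N (G y)) ^+ 2 <= (lam n * (g + L * s)) ^+ 2.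
    rewrite ler_sqr ?nnegrE ?mulr_ge0 ?addr_ge0 ?mulr_ge0 ?nrm_ge0//.
    by rewrite ler_wpM2l.
  have h4 : 0 <= lam n ^+ 2 * (g - L * s) ^+ 2 by rewrite mulr_ge0 ?sqr_ge0.
  have h5 : lam n * - (g * s) <= lam n * ip (y - w0) (G y) by rewrite ler_wpM2l.
  set k := L ^+ 2 * lam n ^+ 2 in k0 *.
  have h6 : 0 <= k * (lam n * (g * s)) by rewrite !mulr_ge0.
  have h7 : 0 <= k ^+ 2 * s ^+ 2 by rewrite mulr_ge0 ?sqr_ge0.
  have h8 : 0 <= lam n ^+ 2 * g ^+ 2 by rewrite mulr_ge0 ?sqr_ge0.
  have h9 : 0 <= lam n * (g * s) by rewrite !mulr_ge0.
  rewrite -/s; apply: (@le_trans _ _ (s ^+ 2 + 2 * (lam n * (g * s)) +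
     2 * (lam n ^+ 2 * g ^+ 2) + 2 * k * s ^+ 2)).
    by move: h3 h4; rewrite /k; lra.
  by rewrite /k in h6 h7 *; lra.
have k0 : 0 <= L ^+ 2 * lam n ^+ 2 by rewrite mulr_ge0// sqr_ge0.
set k := L ^+ 2 * lam n ^+ 2 in hs k0 *.
have sz : s <= N (z n - w0).
  by have := averaged_nonexpansive (z n) w0; rewrite (averaged_fix Fw0).
have [rz|zr] := leP r (N (z n - w0)).
  have := hD _ rz; rewrite -/y -/s => hsD.
  apply: (@le_trans _ _ ((1 + k) * N (z n - w0))); first by nra.
  by rewrite ler_wpM2l ?le_max ?lexx//; lra.
apply: (@le_trans _ _ ((1 + k) * (r + D))); first by nra.
by rewrite ler_wpM2l ?le_max ?lexx ?orbT//; lra.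
Qed.

(** At a bounded distance from w0 but away from the solutions, x is uniformly
    far from being fixed, or its image has a value uniformly above the minimum.
    Indeed the maximum of the two quantities is continuous, and if it is not
    positive at x then x is a solution. *)
Lemma hsd_separation B r : 0 < r -> exists2 rho : R, 0 < rho &
  forall x, N (x - w0) <= B -> r <= setdist ip minFix x ->
  rho <= N (x - T x) \/ (forall y, minFix y -> rho <= Th (A x) - Th y).
Proof.
move=> r0; have [x0 mx0] := minFix_nonempty.
have mE y : minFix y -> Th y = Th x0.
  by move=> [Fy hy]; case: mx0 => F0 h0; apply/eqP; rewrite eq_le hy// h0.
pose K := [set x | N (x - w0) <= B] `&` [set x | - setdist ip minFix x <= - r].
pose h x := Num.max (N (x - T x)) (Th (A x) - Th x0).
have [||||rho rho0 hrho] := @closed_pos _ _ _ E K h (B + N w0).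
- apply: eclosedI; apply: eclosed_le; first exact: econt_nrm.
  by apply: econt_setdistN => //; exists x0.
- move=> x e e0; have [d1 d10 h1] := econt_residual x e0.
  have [d2 d20 h2] := econt_gradient (A x) e0.
  exists (Num.min d1 d2); first by rewrite lt_min d10.
  move=> y; rewrite lt_min => /andP[/h1 yd1 yd2].
  have /h2 : N (A y - A x) < d2.
    exact: le_lt_trans (averaged_nonexpansive _ _) yd2.
  rewrite ltr_norml => /andP[h3 h4]; rewrite ltr_norml in yd1.
  case/andP: yd1 => h5 h6; rewrite /h ltr_norml !maxEle.
  by case: ifP => ?; case: ifP => ?; apply/andP; split; lra.
- move=> x [/= xB _]; have := nrmD E (x - w0) w0; rewrite subrK; lra.
- move=> x [/= _]; rewrite lerN2 => rx; rewrite /h lt_max.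
  have [//|x_le0 /=] := ltP 0 (N (x - T x)).
  have Fx : Fix T x.
    have /(nrm_eq0 E)/eqP : N (x - T x) = 0.
      by apply/eqP; rewrite eq_le x_le0 nrm_ge0.
    by rewrite subr_eq0 => /eqP.
  rewrite averaged_fix// subr_gt0 ltNge; apply/negP => hx.
  have : setdist ip minFix x <= N (x - x).
    apply: setdist_le => //; split => // y Fy; apply: le_trans hx _.
    by case: mx0 => _; exact.
  by rewrite subrr (nrm0 E); lra.
exists rho => // x xB rx.
have : rho <= h x by apply: hrho; split => //=; rewrite lerN2.
rewrite /h le_max => /orP[|] hh; [by left|right=> y my].
by rewrite (mE _ my).
Qed.

(** With w a solution and y = A z_n, the quantity |z_(n+1) - w|^2 is at most
    |z_n - w|^2 - c |z_n - T z_n|^2 - 2 lam <G y, y - w> + lam^2 |G y|^2.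
    By [hsd_separation], away from the solutions either the second term is
    bounded away from 0 and dominates the others as lam tends to 0, or
    <G y, y - w> >= Th y - Th w >= rho. In both cases the squared distance
    to the solution set decreases by a fixed multiple of lam, and
    [vanishing_of_descent] applies. *)
Theorem hsd_convergence r : 0 < r ->
  exists n0, forall n, (n0 <= n)%N -> setdist ip minFix (A (z n)) < r.
Proof.
move=> r_gt0; have [_ lam0] := ell2_bounded_vanishing lam2.
have lamS := non_ell1_unbounded lam_ge0 lam1.
have [B [n1 hB]] := hsd_bounded.
have m0 := minFix_nonempty.
pose d n := setdist ip minFix (z n).
have dA n : setdist ip minFix (A (z n)) <= d n.
  apply: setdist_contract => // y [Fy _].
  by have := averaged_nonexpansive (z n) y; rewrite (averaged_fix Fy).
pose g := N (G w0) + L * B.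
have hG n : (n1 <= n)%N -> N (G (A (z n))) <= g.
  move=> /hB zB; apply: le_trans (gradient_nrm_le w0 _) _.
  rewrite lerD2l ler_wpM2l//; apply: le_trans zB.
  by have := averaged_nonexpansive (z n) w0; rewrite (averaged_fix Fw0).
have g0 : 0 <= g by apply: le_trans (hG n1 (leqnn _)); exact: nrm_ge0.
have stepd n : (n1 <= n)%N -> d n.+1 <= d n + g * lam n.
  move=> hn; apply: le_trans (setdist_lip E m0 _ (A (z n))) _.
  rewrite addrC lerD// hz addrAC subrr sub0r (nrmN E) (nrmZ E) ger0_norm//.
  by rewrite mulrC ler_wpM2r// hG.
have d0 n : 0 <= d n by exact: setdist_ge0.
have [|n0 hn0] := vanishing_of_descent d0 lam_ge0 g0 stepd lam0 lamS _ r_gt0;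
  last by exists n0 => n /hn0; exact: le_lt_trans.
move=> s s0; have [rho rho0 hrho] := hsd_separation B s0.
have B0' : 0 <= B + B0 + N w0.
  have := le_trans (nrm_ge0 ip _) (hB n1 (leqnn _)); have := nrm_ge0 ip w0.
  have := le_trans (nrm_ge0 ip _) (FixB Fw0); lra.
pose C := B + B0 + N w0.
exists (Num.min 1 rho); first by rewrite lt_min ltr01.
(* below the first threshold lam^2 g^2 <= lam rho; below the second one the
   gain c rho^2 exceeds lam (2 g C + g^2 + 1) *)
have [|n2 hn2] := lam0 (rho / (g ^+ 2 + 1)).
  by rewrite divr_gt0// ltr_wpDl// sqr_ge0.
have [|n3 hn3] := lam0 (c * rho ^+ 2 / (2 * g * C + g ^+ 2 + 1)).
  have := sqr_ge0 g; have : 0 <= 2 * g * C by rewrite !mulr_ge0.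
  move=> ? ?; apply: divr_gt0; last by lra.
  by apply: mulr_gt0 => //; exact: exprn_gt0.
have [|n4 hn4] := lam0 1 => //.
exists (maxn (maxn n1 n2) (maxn n3 n4)) => n hn ds.
have hn1' : (n1 <= n)%N by lia.
have hl2 : lam n < rho / (g ^+ 2 + 1) by apply: hn2; lia.
have hl3 : lam n < c * rho ^+ 2 / (2 * g * C + g ^+ 2 + 1) by apply: hn3; lia.
have hl4 : lam n < 1 by apply: hn4; lia.
have l0 := lam_ge0 n.
have gg := sqr_ge0 g.
have gC : 0 <= 2 * g * C by rewrite !mulr_ge0.
rewrite ltr_pdivlMr in hl2; last by lra.
rewrite ltr_pdivlMr in hl3; last by lra.
set eta := Num.min 1 rho.
have eta1 : eta <= 1 by rewrite /eta ge_min lexx.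
have eta2 : eta <= rho by rewrite /eta ge_min lexx orbT.
have le1 : eta * lam n <= lam n by nra.
have le2 : eta * lam n <= rho * lam n by rewrite ler_wpM2r.
have lsq : lam n ^+ 2 <= lam n by rewrite expr2; nra.
have eta0 : 0 <= eta by rewrite /eta le_min ler01 ltW.
apply: setdist_sqr_le => //.
  by rewrite addr_ge0 ?sqr_ge0// mulr_ge0.
move=> y my; case: (my) => Fy _.
rewrite hz addrAC (nrm_sqrB E) (nrmZ E) (ger0_norm l0) (ipZr E) (ipC E).
set u := A (z n).
have hGu : (lam n * N (G u)) ^+ 2 <= lam n ^+ 2 * g ^+ 2.
  rewrite exprMn ler_wpM2l ?sqr_ge0// ler_sqr ?nnegrE ?nrm_ge0//.
  exact: hG.
have hat := averaged_attracting (z n) Fy; rewrite -/u in hat.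
have lg : lam n ^+ 2 * g ^+ 2 <= lam n * g ^+ 2 by rewrite ler_wpM2r.
have [hres|hth] := hrho _ (hB n hn1') ds.
  have hc : c * rho ^+ 2 <= c * N (z n - T (z n)) ^+ 2.
    rewrite ler_wpM2l ?(ltW c_gt0)// ler_sqr ?nnegrE ?nrm_ge0//.
    exact: ltW.
  have : - (g * C) <= ip (G u) (u - y).
    have := ip_abs_le E (G u) (u - y); rewrite ler_norml => /andP[hh _].
    apply: le_trans hh; rewrite lerN2 ler_pM ?nrm_ge0 ?hG//.
    apply: le_trans (_ : N (z n - y) <= _).
      by have := averaged_nonexpansive (z n) y; rewrite (averaged_fix Fy).
    apply: le_trans (nrm_tri E w0 _ _) _.
    have := nrmD E w0 (- y); rewrite (nrmN E) /C.
    have := hB n hn1'; have := FixB Fy; lra.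
  move=> /(ler_wpM2l l0); lra.
have := hth _ my; rewrite -/u => hth'.
have h1 : rho <= ip (G u) (u - y).
  by have := Gsub u y; rewrite -(opprB u y) (ipNr E); lra.
have h2 : lam n * rho <= lam n * ip (G u) (u - y) by rewrite ler_wpM2l.
have h3 : 0 <= c * N (z n - T (z n)) ^+ 2 by rewrite mulr_ge0 ?sqr_ge0 ?ltW.
have h4 : lam n ^+ 2 * g ^+ 2 <= lam n * rho.
  by rewrite expr2 -mulrA ler_wpM2l//; nra.
lra.
Qed.

End HybridSteepestDescent.

(** * Fixed points from bounded approximate fixed points *)
Section ApproximateFixedPoints.
Variables (R : realType) (V : lmodType R) (ip : V -> V -> R).
Hypothesis E : euclidean ip.
Local Notation N := (nrm ip).
Variable T : V -> V.
Hypothesis Tne : forall x y, N (T x - T y) <= N (x - y).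

(** The residual |x - k T x| has a minimizer on a ball that k T maps to itself;
    applying the contraction to the minimizer would decrease a positive
    residual. *)
Lemma contraction_fixpoint (k : R) : 0 <= k < 1 -> exists x, k *: T x = x.
Proof.
case/andP=> k0 k1; pose S x := k *: T x.
have Sk x y : N (S x - S y) <= k * N (x - y).
  by rewrite /S -scalerBr (nrmZ E) ger0_norm// ler_wpM2l.
pose rho := k * N (T 0) / (1 - k).
have rho0 : 0 <= rho.
  by rewrite divr_ge0 ?mulr_ge0 ?nrm_ge0// subr_ge0 ltW.
have rhoE : k * N (T 0) = rho * (1 - k) by rewrite /rho divfK// gt_eqF// subr_gt0.
pose K := [set x | N (x - 0) <= rho].
have SK x : K x -> K (S x).
  rewrite /K /= !subr0 => xr; have := Sk x 0; rewrite subr0 => h1.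
  have := nrmD E (S x - S 0) (S 0); rewrite subrK.
  have -> : N (S 0) = k * N (T 0) by rewrite /S (nrmZ E) ger0_norm.
  have := ler_wpM2l k0 xr; lra.
have [|||||x Kx hx] := @closed_argmin _ _ _ E K (fun x => N (x - S x)) rho 0.
- exact: eclosed_le (econt_nrm E 0).
- apply: (econt_residual E) => x y; apply: le_trans (Sk x y) _.
  by rewrite ler_piMl ?nrm_ge0// ltW.
- by exists 0; rewrite /K /= subrr (nrm0 E).
- by move=> x; rewrite /K /= subr0.
- by move=> x _; exact: nrm_ge0.
exists x; have := hx _ (SK _ Kx); have := Sk x (S x) => h1 h2.
have h3 : N (x - S x) = 0.
  apply/eqP; rewrite eq_le nrm_ge0 andbT; have := nrm_ge0 ip (x - S x); nra.
by have /eqP := nrm_eq0 E h3; rewrite subr_eq0 => /eqP.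
Qed.

(** The contraction T / (1 + 2 d) has a fixed point for each d > 0. If these
    points stay bounded as d tends to 0, a cluster point is fixed by T. The
    parametrization by 1 + 2 d makes the prox argument of the Douglas-Rachford
    operator a shift by d, see [drs_resolvent]. *)
Lemma fixpoint_of_bounded_resolvents (B : R) :
  (forall (d : R) x, 0 < d <= 1 -> T x = (1 + 2 * d) *: x -> N x <= B) ->
  Fix T !=set0.
Proof.
move=> hB.
have seqx n : exists x, T x = (1 + 2 * n.+1%:R^-1) *: x /\ N x <= B.
  pose d : R := n.+1%:R^-1.
  have d0 : 0 < d by rewrite invr_gt0.
  have d1 : d <= 1 by rewrite invf_le1// ler1n.
  have [|x hx] := @contraction_fixpoint (1 + 2 * d)^-1.
    rewrite invr_ge0 invf_lt1; lra.
  have Tx : T x = (1 + 2 * d) *: x.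
    by rewrite -{2}hx scalerA divff ?scale1r//; lra.
  by exists x; split=> //; apply: hB Tx; rewrite d0.
have [u hu] := choice seqx.
have [w hw] := nrm_cluster E (fun n => (hu n).2).
exists w; apply/eqP; rewrite -subr_eq0; apply/eqP/(nrm_eq0 E)/eqP.
rewrite eq_le nrm_ge0 andbT; apply/ler_addgt0Pl => e e0; rewrite addr0.
have B0 : 0 <= B by exact: le_trans (nrm_ge0 _ _) (hu 0%N).2.
have e4 : 0 < e / 4 by rewrite divr_gt0.
pose n0 := Num.truncn (4 * B / e).
have [n n0n hn] := hw _ e4 n0.
have dB : 2 * n.+1%:R^-1 * B <= e / 2.
  have h : 4 * B / e < n.+1%:R.
    by apply: lt_le_trans (truncnS_gt _) _; rewrite ler_nat ltnS.
  rewrite ltr_pdivrMr// in h; rewrite mulrAC ler_pdivrMr//; lra.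
apply: le_trans (nrm_tri E (T (u n)) _ _) _.
have h1 : N (T w - T (u n)) < e / 4.
  by apply: le_lt_trans (Tne _ _) _; rewrite (nrmBC E).
apply: le_trans (lerD (ltW h1) (nrm_tri E (u n) _ _)) _.
have h2 : N (T (u n) - u n) <= e / 2.
  rewrite (hu n).1 scalerDl scale1r addrAC subrr add0r (nrmZ E) ger0_norm.
    by apply: le_trans dB; rewrite ler_wpM2l ?(hu n).2// mulr_ge0// invr_ge0.
  by rewrite mulr_ge0// invr_ge0.
lra.
Qed.

End ApproximateFixedPoints.

(** * Proximity operators *)
Section ConvexFunctions.
Variables (R : realType) (V : lmodType R) (ip : V -> V -> R).
Hypothesis E : euclidean ip.
Local Notation N := (nrm ip).
Implicit Types (f : V -> \bar R) (x y nu : V).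

(** Closed convex functions are represented as suprema of affine functions:
    convexity, lower semicontinuity and stability under the addition of a
    squared norm all follow at once. *)
Definition sup_of_affine f := forall x (r : R), (r%:E < f x)%E ->
  exists nu (k : R), (forall y, ((ip nu y + k)%:E <= f y)%E) /\ r < ip nu x + k.

Definition subgrad f x nu := f x \is a fin_num /\
  forall y, (f x + (ip nu (y - x))%:E <= f y)%E.

Definition moreau f x y := (f y + (2^-1 * N (x - y) ^+ 2)%:E)%E.

Record nonneg_closed_convex f : Prop := ClosedConvex {
  cc_affine : sup_of_affine f;
  cc_ge0 : forall x, (0 <= f x)%E;
  cc_proper : exists x, f x \is a fin_num }.

Lemma sup_of_affine_elsc f : sup_of_affine f -> elsc ip f.
Proof.
move=> hf x a /hf[nu [k [hk xk]]].
have ipc : econt ip (ip nu).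
  apply: (@econt_lip _ _ _ _ (N nu)) => y w.
  by rewrite -(ipNr E) -(ipDr E); exact: ip_abs_le.
have /(ipc x)[d d0 hd] : 0 < ip nu x + k - a by rewrite subr_gt0.
exists d => // y /hd; rewrite ltr_norml => /andP[h _].
by apply: lt_le_trans (hk y); rewrite lte_fin; lra.
Qed.

Lemma sup_of_affine_convex f x y (a b t : R) : sup_of_affine f -> 0 <= t <= 1 ->
  (f x <= a%:E)%E -> (f y <= b%:E)%E ->
  (f ((1 - t) *: x + t *: y)%R <= ((1 - t) * a + t * b)%:E)%E.
Proof.
move=> hf /andP[t0 t1] fx fy; rewrite leNgt; apply/negP => /hf[nu [k [hk]]].
have := le_trans (hk x) fx; have := le_trans (hk y) fy.
rewrite !lee_fin !(ipE E); nra.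
Qed.

(** The squared norm is above its tangent at y, so adding this tangent to an
    affine minorant of f that is nearly exact at y gives one of the
    regularized function. *)
Lemma sup_of_affine_moreau f x : sup_of_affine f -> sup_of_affine (moreau f x).
Proof.
move=> hf y r hr.
pose s := 2^-1 * N (x - y) ^+ 2.
have /hf[nu [k [hk ry]]] : ((r - s)%:E < f y)%E.
  by move: hr; rewrite /moreau -/s; case: (f y) => [a| |]//=;
    rewrite ?ltry// -?EFinD ?lte_fin; lra.
exists (nu + (y - x)), (k + s - ip (y - x) y); split; last first.
  by rewrite (ipDl E); lra.
move=> w; rewrite /moreau; have -> : ip (nu + (y - x)) w + (k + s - ip (y - x) y) =
  (ip nu w + k) + (s + ip (y - x) (w - y)) by rewrite !(ipE E); ring.
rewrite EFinD leeD// lee_fin.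
have -> : x - w = (x - y) - (w - y) by rewrite opprB addrA subrK.
rewrite (nrm_sqrB E (x - y)) -(opprB x y) (ipNl E) -/s.
have := sqr_ge0 (N (w - y)); rewrite /s; lra.
Qed.

Lemma prox_exists f x : nonneg_closed_convex f ->
  argmin setT (moreau f x) !=set0.
Proof.
case=> hf f0 [x0 fx0].
pose r0 := fine (moreau f x x0).
have mx0 : moreau f x x0 = r0%:E by rewrite /r0 fineK// fin_numD fx0.
have m0 y : (0 <= moreau f x y)%E.
  by rewrite adde_ge0// lee_fin mulr_ge0 ?sqr_ge0// invr_ge0.
have [||||y hy] := @lsc_argmin _ _ _ E (moreau f x) x0 r0 0 (N x + 2 * (r0 + 1)  + 1).
- exact/sup_of_affine_elsc/sup_of_affine_moreau.
- by rewrite mx0.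
- exact: m0.
- move=> y hy.
  have : ((2^-1 * N (x - y) ^+ 2)%:E <= (r0 + 1)%:E)%E.
    by apply: le_trans hy; rewrite leeDr.
  rewrite lee_fin => h1.
  have h2 := sqr_ge0 (N (x - y) - 1).
  have := nrmD E x (y - x); rewrite addrC subrK (nrmBC E y x).
  have := sqr_ge0 (N (x - y)); nra.
by exists y; split.
Qed.

(** First order condition. Comparing p with p + t (y - p) and dividing by t
    gives f p + <x - p, y - p> <= f y + (t/2) |y - p|^2; then t tends to 0. *)
Lemma prox_subgrad f x p : nonneg_closed_convex f -> argmin setT (moreau f x) p ->
  subgrad f p (x - p).
Proof.
case=> hf f0 [x0 fx0] [_ hp].
have fp : f p \is a fin_num.
  have := hp x0 I; rewrite /moreau; have := f0 p.
  by case: (f p) => [a| |]//; rewrite -(fineK fx0).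
split=> // y; have := f0 y; case fy : (f y) => [b| |]// _; last by rewrite leey.
move: fp (hp); case fpE: (f p) => [a| |]// _ hpy.
rewrite -EFinD lee_fin leNgt; apply/negP => hlt.
pose D := a + ip (x - p) (y - p) - b; pose Q := N (y - p) ^+ 2.
have D0 : 0 < D by rewrite subr_gt0.
have Q0 : 0 <= Q by exact: sqr_ge0.
(* small enough for t Q / 2 < D, where D is the assumed violation *)
pose t := Num.min 1 (D / (Q + 1)).
have t0 : 0 < t by rewrite lt_min ltr01 divr_gt0//; lra.
have t1 : t <= 1 by rewrite ge_min lexx.
have tQ : t * (Q + 1) <= D by rewrite -ler_pdivlMr ?ge_min ?lexx ?orbT//; lra.
have t01 : 0 <= t <= 1 by rewrite ltW.
have := @sup_of_affine_convex f p y a b t hf t01.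
rewrite fpE fy => /(_ (lexx _) (lexx _)) hc.
have := le_trans (hpy ((1 - t) *: p + t *: y) I) (leeD hc (lexx _)).
have -> : x - ((1 - t) *: p + t *: y) = (x - p) - t *: (y - p).
  by rewrite scalerBl scale1r scalerBr !opprD !opprK !addrA addrAC.
rewrite /moreau fpE -!EFinD lee_fin (nrm_sqrB E (x - p)) (nrmZ E) (ger0_norm (ltW t0)).
rewrite exprMn -/Q (ipZr E) => h.
have h1 : t * D <= t * (2^-1 * t * Q) by rewrite /D; lra.
rewrite ler_pM2l// in h1; have := mulr_ge0 (ltW t0) Q0; lra.
Qed.

Lemma subgrad_monotone f x y nu mu : subgrad f x nu -> subgrad f y mu ->
  0 <= ip (nu - mu) (x - y).
Proof.
move=> [fx hx] [fy hy]; have := hx y; have := hy x.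
rewrite -(fineK fx) -(fineK fy) -!EFinD !lee_fin.
by rewrite -(opprB x y) !(ipE E); lra.
Qed.

Lemma subgrad_prox_unique f x p p' :
  subgrad f p (x - p) -> subgrad f p' (x - p') -> p = p'.
Proof.
move=> h1 h2; have := subgrad_monotone h1 h2.
have -> : x - p - (x - p') = - (p - p') by rewrite !opprB addrC addrA subrK.
rewrite (ipNl E) oppr_ge0 -(nrm_sqr E) => h.
have /(nrm_eq0 E)/eqP : N (p - p') = 0.
  by apply/eqP; rewrite -sqrf_eq0 eq_le h sqr_ge0.
by rewrite subr_eq0 => /eqP.
Qed.

Lemma reflected_prox_nonexpansive f x y p p' :
  subgrad f p (x - p) -> subgrad f p' (y - p') ->
  N ((2 *: p - x) - (2 *: p' - y)) <= N (x - y).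
Proof.
move=> h1 h2; have := subgrad_monotone h1 h2.
have -> : 2 *: p - x - (2 *: p' - y) = 2 *: (p - p') - (x - y).
  by rewrite scalerBr !opprB addrACA [RHS]addrACA [- x - _]addrC.
have -> : x - p - (y - p') = (x - y) - (p - p').
  by rewrite !opprB addrACA [RHS]addrACA [- p - y]addrC.
rewrite (ipDl E) (ipNl E) => h; rewrite nrm_le_sqr ?nrm_ge0//.
rewrite (nrm_sqrB E (2 *: _)) (nrmZ E) ger0_norm// exprMn !(nrm_sqr E) (ipZl E).
rewrite (ipC E _ (x - y)); lra.
Qed.

End ConvexFunctions.

(** * The Euclidean spaces R^n and R^m x R^n *)
Section Instances.
Variable R : realType.

Lemma dotE n (x y : 'cV[R]_n) : dot x y = \sum_i x i 0 * y i 0.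
Proof. by rewrite /dot mxE; apply: eq_bigr => i _; rewrite mxE. Qed.

(** Bolzano-Weierstrass, from the compactness of a product of segments. *)
Lemma cV_cluster n (u : nat -> 'cV[R]_n) (B : R) :
  (forall k i, `|u k i 0| <= B) ->
  exists w : 'cV[R]_n, forall e : R, 0 < e -> forall n0, exists2 k, (n0 <= k)%N &
    forall i, `|u k i 0 - w i 0| < e.
Proof.
move=> uB.
have cK := @rV_compact R n (fun=> `[- B, B]%classic) (fun=> @segment_compact R (- B) B).
pose v k : 'rV[R]_n := (u k)^T.
have [w [_ hw]] : [set w : 'rV[R]_n | forall i, `[- B, B]%classic (w 0 i)] `&`
    cluster (v @ \oo) !=set0.
  apply: cK; exists 0%N => // k _ i.
  by rewrite /v mxE /= in_itv/= -ler_norml.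
exists w^T => e e0 n0.
have [|x [[k kn <-]]] := hw (v @` [set k | (n0 <= k)%N])
  (ball w e) _ (nbhsx_ballx w e e0).
  by exists n0 => // k kn; exists k.
move=> [_ hb]; exists k => // i; rewrite mxE distrC.
by have := hb 0 i; rewrite /v mxE.
Qed.

Lemma euclidean_dot n : euclidean (@dot R n).
Proof.
split.
- by move=> x y; rewrite !dotE; apply: eq_bigr => i _; rewrite mulrC.
- move=> x y w; rewrite !dotE -big_split/=; apply: eq_bigr => i _.
  by rewrite mxE mulrDl.
- move=> a x y; rewrite !dotE mulr_sumr; apply: eq_bigr => i _.
  by rewrite mxE mulrA.
- by move=> x; rewrite dotE sumr_ge0// => i _; rewrite -expr2 sqr_ge0.
- move=> x; rewrite dotE => /psumr_eq0P h; apply/matrixP => i k.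
  rewrite ord1 mxE; apply/eqP; rewrite -sqrf_eq0 expr2; apply/eqP.
  by apply: h => // l _; rewrite -expr2 sqr_ge0.
- move=> u B hB.
  have [|w hw] := @cV_cluster n u (Num.sqrt B).
    move=> k i; rewrite -sqrtr_sqr ler_wsqrtr//; apply: le_trans (hB k).
    rewrite dotE (bigD1 i)//= -expr2 lerDl sumr_ge0// => l _.
    by rewrite -expr2 sqr_ge0.
  exists w => e e0 n0.
  have e'0 : 0 < Num.min 1 (e / n.+1%:R) by rewrite lt_min ltr01 divr_gt0.
  have [k kn hk] := hw _ e'0 n0; exists k => //.
  rewrite dotE; apply: (@le_lt_trans _ _ (\sum_(i < n) (e / n.+1%:R))).
    apply: ler_sum => i _; have := hk i; rewrite !mxE -expr2 -real_normK ?num_real//.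
    rewrite lt_min => /andP[h1 h2]; apply: le_trans (ltW h2).
    by rewrite expr2 ler_piMl// ltW.
  rewrite sumr_const card_ord -[ltLHS]mulr_natr mulrAC ltr_pdivrMr//.
  by rewrite ltr_pM2l// ltr_nat.
Qed.

Lemma dot2E m n (u v : 'cV[R]_m * 'cV[R]_n) :
  dot2 u v = dot (col_mx u.1 u.2) (col_mx v.1 v.2).
Proof. by rewrite /dot tr_col_mx mul_row_col mxE. Qed.

Lemma euclidean_dot2 m n : euclidean (@dot2 R m n).
Proof.
have E k := euclidean_dot k; split.
- by move=> x y; rewrite /dot2 !(ipC (E _) x.1) (ipC (E _) x.2).
- by move=> x y w; rewrite /dot2 !(ipDl (E _)) addrACA.
- by move=> a x y; rewrite /dot2 !(ipZl (E _)) mulrDr.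
- by move=> x; rewrite addr_ge0// (ip_ge0 (E _)).
- move=> [x y]; rewrite /dot2 /= => /eqP; rewrite paddr_eq0 ?(ip_ge0 (E _))//.
  by case/andP => /eqP/(ip_eq0 (E _)) -> /eqP/(ip_eq0 (E _)) ->.
- move=> u B hB.
  have [|w hw] := ip_cluster (E (m + n)%N) (u := fun k => col_mx (u k).1 (u k).2) (B := B).
    by move=> k; rewrite -dot2E.
  exists (usubmx w, dsubmx w) => e e0 n0; have [k kn hk] := hw e e0 n0.
  exists k => //; rewrite dot2E; move: hk.
  by rewrite -{1 2}(vsubmxK w) opp_col_mx add_col_mx.
Qed.

Lemma enormE n (x : 'cV[R]_n) : enorm x = nrm (@dot R n) x. Proof. by []. Qed.

Lemma dot_mulmx m n (A : 'M[R]_(m, n)) (x : 'cV[R]_n) (y : 'cV[R]_m) :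
  dot (A *m x) y = dot x (A^T *m y).
Proof. by rewrite /dot trmx_mul mulmxA. Qed.

Lemma entry_le_enorm n (x : 'cV[R]_n) i : `|x i 0| <= enorm x.
Proof.
rewrite -sqrtr_sqr ler_wsqrtr// dotE (bigD1 i)//= -expr2 lerDl sumr_ge0// => l _.
by rewrite -expr2 sqr_ge0.
Qed.

Lemma enorm_le_norm1 n (x : 'cV[R]_n) : enorm x <= norm1 x.
Proof.
have x0 : 0 <= norm1 x by exact: sumr_ge0.
rewrite -(ger0_norm x0) -sqrtr_sqr ler_wsqrtr// dotE expr2 {1}/norm1 mulr_suml.
apply: ler_sum => i _; apply: le_trans (ler_norm _) _; rewrite normrM.
by rewrite ler_wpM2l// /norm1 (bigD1 i)//= lerDl sumr_ge0.
Qed.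

Lemma norm1_le_enorm n (x : 'cV[R]_n) : norm1 x <= n%:R * enorm x.
Proof.
apply: le_trans (ler_sum _ (fun i _ => entry_le_enorm x i)) _.
by rewrite sumr_const card_ord mulr_natl.
Qed.

Lemma enorm_mulmx_le m n (A : 'M[R]_(m, n)) :
  exists2 k : R, 0 <= k & forall x, enorm (A *m x) <= k * enorm x.
Proof.
exists (\sum_i \sum_j `|A i j|); first by do 2! (apply: sumr_ge0 => ? _).
move=> x; apply: le_trans (enorm_le_norm1 _) _; rewrite mulr_suml.
apply: ler_sum => i _; rewrite mxE mulr_suml.
apply: le_trans (ler_norm_sum _ _ _) _; apply: ler_sum => j _.
by rewrite normrM ler_wpM2l// entry_le_enorm.
Qed.

(** The linear form with coefficients sgn x_i is below the l1 norm and touches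
    it at x. *)
Lemma norm1_closed_convex n :
  nonneg_closed_convex (@dot R n) (fun b => (norm1 b)%:E).
Proof.
split.
- move=> x r; rewrite lte_fin => rx; exists (\col_i Num.sg (x i 0)), 0.
  split => [y|]; rewrite ?addr0 ?lee_fin dotE.
    apply: ler_sum => i _; rewrite mxE; apply: le_trans (ler_norm _) _.
    by rewrite normrM ler_piMl// normr_sg lern1 leq_b1.
  apply: lt_le_trans rx _; rewrite le_eqVlt; apply/orP; left; apply/eqP.
  by apply: eq_bigr => i _; rewrite mxE -normrEsg.
- by move=> x; rewrite lee_fin; exact: sumr_ge0.
- by exists 0.
Qed.

(** Testing the subgradient inequality at x + nu gives
    |nu|^2 <= |nu|_1 <= n |nu|. *)
Lemma subgrad_norm1_bounded n (x nu : 'cV[R]_n) :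
  subgrad (@dot R n) (fun b => (norm1 b)%:E) x nu -> enorm nu <= n%:R.
Proof.
move=> [_ h]; have := h (x + nu).
rewrite [x + nu - x]addrAC subrr add0r -EFinD lee_fin => {}h.
have h1 : norm1 (x + nu) <= norm1 x + norm1 nu.
  rewrite /norm1 -big_split/=; apply: ler_sum => i _; rewrite mxE; exact: ler_normD.
have h2 := norm1_le_enorm nu.
have := nrm_sqr (euclidean_dot n) nu; rewrite -enormE => h3.
have h4 : enorm nu ^+ 2 <= n%:R * enorm nu by lra.
have [h0|h0] := eqVneq (enorm nu) 0; first by rewrite h0.
have nu0 : 0 < enorm nu by rewrite lt_def h0; exact: sqrtr_ge0.
by rewrite expr2 ler_pM2r in h4.
Qed.

Lemma prox_is_subgrad n (f : 'cV[R]_n -> \bar R) x :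
  nonneg_closed_convex (@dot R n) f ->
  subgrad (@dot R n) f (prox f x) (x - prox f x).
Proof.
move=> hf; have E := euclidean_dot n.
apply: (prox_subgrad E hf); rewrite /prox; case: xgetP => [y -> //|].
by have [y hy] := prox_exists E x hf => /(_ y).
Qed.

Lemma prox_eq n (f : 'cV[R]_n -> \bar R) x p :
  nonneg_closed_convex (@dot R n) f ->
  subgrad (@dot R n) f p (x - p) -> prox f x = p.
Proof.
move=> hf hp; apply: (subgrad_prox_unique (euclidean_dot n) _ hp).
exact: prox_is_subgrad.
Qed.

End Instances.

(** * Projection onto the graph of a matrix *)
Section GraphProjection.
Variables (R : realType) (m p : nat) (M : 'M[R]_(m, p)).
Local Notation K := (resM M).
Implicit Types u : 'cV[R]_p * 'cV[R]_m.

(** A row vector in the kernel has a transpose w with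
    |w|^2 + |M^T w|^2 = 0. *)
Lemma gram_unit : (1%:M + M *m M^T) \in unitmx.
Proof.
rewrite -row_free_unit; apply: inj_row_free => v hv.
have Ep := euclidean_dot R p; have Em := euclidean_dot R m.
have : dot v^T v^T + dot (M^T *m v^T) (M^T *m v^T) = 0.
  rewrite dot_mulmx trmxK -(ipDr Em) mulmxA -[X in _ + X]mulmxA.
  have -> : v^T + M *m (M^T *m v^T) = (v *m (1%:M + M *m M^T))^T.
    by rewrite mulmxDr mulmx1 linearD/= !trmx_mul trmxK mulmxA.
  by rewrite hv trmx0 (ipC Em) (ip0l Em).
move/eqP; rewrite paddr_eq0 ?(ip_ge0 Em) ?(ip_ge0 Ep)// => /andP[/eqP h _].
by rewrite -[v]trmxK (ip_eq0 Em h) trmx0.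
Qed.

Lemma gram_resM : (1%:M + M *m M^T) *m K = 1%:M.
Proof. exact: mulmxV gram_unit. Qed.

Lemma resM_sym : K^T = K.
Proof. by rewrite /resM trmx_inv linearD/= trmx1 trmx_mul trmxK. Qed.

Lemma Xi_graph v n : Xi M (v - M^T *m n, M *m v + n) = v.
Proof.
have h : K *m (1%:M + M *m M^T) = 1%:M by exact: mulVmx gram_unit.
rewrite /Xi /= [M *m (v - _)]mulmxBr.
have -> : M *m v - M *m (M^T *m n) - (M *m v + n) = - ((1%:M + M *m M^T) *m n).
  by rewrite mulmxDl mul1mx -mulmxA [in LHS]opprD addrACA subrr add0r opprD addrC.
by rewrite mulmxN opprK -[M^T *m K *m _]mulmxA [K *m _]mulmxA h mul1mx subrK.
Qed.

(** R^p x R^m is the orthogonal sum of the graph of M, made of the pairs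
    (v, M v), and of the pairs (- M^T n, n). In these coordinates Xi returns v
    by [Xi_graph], so u |-> (Xi u, M (Xi u)) is the orthogonal projection onto
    the graph. *)
Lemma graph_decomposition u :
  exists v n, u = (v - M^T *m n, M *m v + n).
Proof.
case: u => b c; set v := Xi M (b, c); exists v, (c - M *m v).
congr pair; last by rewrite addrC subrK.
set d := M *m b - c; have vE : v = b - M^T *m (K *m d) by rewrite mulmxA.
have -> : c - M *m v = - (K *m d).
  have := congr1 (fun A => A *m d) gram_resM.
  rewrite mul1mx -mulmxA mulmxDl mul1mx -mulmxA => hd.
  rewrite vE mulmxBr opprB addrCA -[c - M *m b]opprB -/d -{2}hd opprD addrCA.
  by rewrite subrr addr0.
by rewrite mulmxN opprK vE subrK.
Qed.

Lemma XiD u u' : Xi M (u + u') = Xi M u + Xi M u'.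
Proof.
rewrite /Xi -[(u + u').1]/(u.1 + u'.1) -[(u + u').2]/(u.2 + u'.2).
rewrite [M *m (_ + _)]mulmxDr opprD.
by rewrite addrACA [in LHS]mulmxDr [in LHS]opprD addrACA.
Qed.

Lemma XiZ (a : R) u : Xi M (a *: u) = a *: Xi M u.
Proof.
rewrite /Xi -[(a *: u).1]/(a *: u.1) -[(a *: u).2]/(a *: u.2).
by rewrite -scalemxAr -scalerBr -scalemxAr -scalerBr.
Qed.

Lemma XiB u u' : Xi M (u - u') = Xi M u - Xi M u'.
Proof. by rewrite -scaleN1r XiD XiZ scaleN1r. Qed.

(** The adjoint of Xi; it carries the gradient of Psi to that of the composite
    of Psi and Xi. *)
Definition Xi_adj (w : 'cV[R]_p) : 'cV[R]_p * 'cV[R]_m :=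
  ((1%:M - M^T *m K *m M) *m w, K *m M *m w).

Lemma Xi_adjP w u : dot2 (Xi_adj w) u = dot w (Xi M u).
Proof.
have E := euclidean_dot R p.
rewrite /dot2 /Xi_adj /= !dot_mulmx -(ipDr E) /Xi; congr dot.
rewrite linearB/= trmx1 !trmx_mul trmxK resM_sym mulmxBl mul1mx.
by rewrite mulmxBr opprB !mulmxA addrAC addrA.
Qed.

Lemma Xi_contraction u : enorm (Xi M u) <= enorm2 u.
Proof.
have Ep := euclidean_dot R p; have Em := euclidean_dot R m.
have [v [n ->]] := graph_decomposition u.
rewrite Xi_graph /enorm2 ler_wsqrtr// /dot2 /=.
rewrite -!(nrm_sqr Ep) -!(nrm_sqr Em) (nrm_sqrB Ep) (nrm_sqrD Em) dot_mulmx.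
have := sqr_ge0 (nrm (@dot R p) (M^T *m n)); have := sqr_ge0 (nrm (@dot R m) n).
have := sqr_ge0 (nrm (@dot R m) (M *m v)); lra.
Qed.

Definition graph_reflection u : 'cV[R]_p * 'cV[R]_m :=
  (2 *: Xi M u - u.1, 2 *: (M *m Xi M u) - u.2).

Lemma graph_reflectionE v n :
  graph_reflection (v - M^T *m n, M *m v + n) = (v + M^T *m n, M *m v - n).
Proof.
rewrite /graph_reflection Xi_graph /= opprB opprD !scaler_nat !mulr2n.
by congr pair; rewrite ?[_ - v]addrC ?addrA ?addrK// addrAC addrK.
Qed.

Lemma graph_reflectionB u u' :
  graph_reflection u - graph_reflection u' = graph_reflection (u - u').
Proof.
rewrite /graph_reflection XiB (mulmxBr M (Xi M u)).
rewrite (scalerBr 2 (Xi M u)) (scalerBr 2 (M *m Xi M u)).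
have sub4 (V : zmodType) (a b c d : V) : a - b - (c - d) = a - c - (b - d).
  by rewrite !opprB addrACA [RHS]addrACA; congr (_ + _); exact: addrC.
by apply: injective_projections; exact: sub4.
Qed.

Lemma graph_reflection_isometry u : enorm2 (graph_reflection u) = enorm2 u.
Proof.
have Ep := euclidean_dot R p; have Em := euclidean_dot R m.
have [v [n ->]] := graph_decomposition u.
rewrite graph_reflectionE /enorm2; congr Num.sqrt; rewrite /dot2 /=.
rewrite -!(nrm_sqr Ep) -!(nrm_sqr Em) !(nrm_sqrB Ep) !(nrm_sqrB Em).
rewrite !(nrm_sqrD Em) !(nrm_sqrD Ep) dot_mulmx; ring.
Qed.

End GraphProjection.

(** * The Douglas-Rachford operator of f + g o M on the graph of M *)
Section DouglasRachford.
Variables (R : realType) (m p : nat) (M : 'M[R]_(m, p)).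
Variables (f : 'cV[R]_p -> \bar R) (g : 'cV[R]_m -> \bar R).
Hypothesis hf : nonneg_closed_convex (@dot R p) f.
Hypothesis hg : nonneg_closed_convex (@dot R m) g.
Let Ep := euclidean_dot R p.
Let Em := euclidean_dot R m.
Let E2 := euclidean_dot2 R p m.
Local Notation df := (subgrad (@dot R p) f).
Local Notation dg := (subgrad (@dot R m) g).

Definition drs (u : 'cV[R]_p * 'cV[R]_m) : 'cV[R]_p * 'cV[R]_m :=
  let w := graph_reflection M u in
  (2 *: prox f w.1 - w.1, 2 *: prox g w.2 - w.2).

Lemma enorm2_sqr (u : 'cV[R]_p * 'cV[R]_m) :
  enorm2 u ^+ 2 = enorm u.1 ^+ 2 + enorm u.2 ^+ 2.
Proof. by rewrite !(nrm_sqr Ep) !(nrm_sqr Em) (nrm_sqr E2). Qed.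

Lemma enorm2_le (u : 'cV[R]_p * 'cV[R]_m) : enorm2 u <= enorm u.1 + enorm u.2.
Proof.
have h1 := nrm_ge0 (@dot R p) u.1; have h2 := nrm_ge0 (@dot R m) u.2.
rewrite nrm_le_sqr ?addr_ge0// enorm2_sqr sqrrD -addrA lerD2l lerDr.
by rewrite mulrn_wge0// mulr_ge0.
Qed.

Lemma drs_nonexpansive u u' : enorm2 (drs u - drs u') <= enorm2 (u - u').
Proof.
rewrite -(graph_reflection_isometry M (u - u')) -graph_reflectionB.
set w := graph_reflection M u; set w' := graph_reflection M u'.
rewrite nrm_le_sqr ?nrm_ge0// !enorm2_sqr; apply: lerD.
  rewrite ler_sqr ?nnegrE ?nrm_ge0//.
  exact: (reflected_prox_nonexpansive Ep (prox_is_subgrad _ hf)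
    (prox_is_subgrad _ hf)).
rewrite ler_sqr ?nnegrE ?nrm_ge0//.
exact: (reflected_prox_nonexpansive Em (prox_is_subgrad _ hg)
  (prox_is_subgrad _ hg)).
Qed.

(** The reflection through the graph sends (b, c) to (v + M^T n, M v - n), and
    the equation says that the prox of this point is (v, M v) + d (b, c); the
    prox inclusion then names the two subgradients. *)
Lemma drs_resolvent (d : R) v n (b := v - M^T *m n) (c := M *m v + n) :
  drs (b, c) = (1 + 2 * d) *: (b, c) ->
  df (v + d *: b) (M^T *m n - d *: b) /\ dg (M *m v + d *: c) (- n - d *: c).
Proof.
rewrite /drs graph_reflectionE /= => -[hb hc]; move: hb hc.
have := prox_is_subgrad (v + M^T *m n) hf; set x := prox f _ => hx.
have := prox_is_subgrad (M *m v - n) hg; set y := prox g _ => hy hb hc.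
have xE : x = v + d *: b.
  move: hb; rewrite /b; move: (M^T *m n) => a hb; apply/matrixP => i k.
  have := congr1 (fun A : 'cV[R]_p => A i k) hb; rewrite !mxE; lra.
have yE : y = M *m v + d *: c.
  move: hc; rewrite /c; move: (M *m v) => a hc; apply/matrixP => i k.
  have := congr1 (fun A : 'cV[R]_m => A i k) hc; rewrite !mxE; lra.
rewrite -xE -yE; split.
  suff -> : M^T *m n - d *: b = v + M^T *m n - x by [].
  by rewrite xE opprD addrA [v + _]addrC addrK.
suff -> : - n - d *: c = M *m v - n - y by [].
by rewrite yE opprD addrA [M *m v - n]addrC addrK.
Qed.

Lemma Fix_drsP v n : Fix drs (v - M^T *m n, M *m v + n) <->
  df v (M^T *m n) /\ dg (M *m v) (- n).
Proof.
split=> [Fu|[hv hn]].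
  have /= := @drs_resolvent 0 v n; rewrite mulr0 addr0 !scale0r !subr0 !addr0.
  by apply; rewrite scale1r.
rewrite /Fix /= /drs graph_reflectionE /=.
rewrite (@prox_eq _ _ _ _ v hf); last by rewrite addrC addKr.
rewrite (@prox_eq _ _ _ _ (M *m v) hg); last by rewrite addrC addKr.
by rewrite !scaler_nat !mulr2n !opprD opprK !addrA !addrK.
Qed.

(** The objective function of the lower level problem. *)
Definition primal (b : 'cV[R]_p) : \bar R := (g (M *m b)%R + f b)%E.

(** The two subgradient inequalities add up, and their linear terms cancel
    because n is moved through M by transposition. *)
Lemma KKT_primal v n : df v (M^T *m n) -> dg (M *m v) (- n) ->
  argmin setT primal v.
Proof.
move=> [fv hv] [gv hn]; split => // y _.
apply: le_trans (leeD (hn (M *m y)) (hv y)).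
rewrite /primal -(fineK fv) -(fineK gv) -!EFinD lee_fin -mulmxBr.
rewrite (ipNl Em) (ipC Em n) (dot_mulmx M) (ipC Ep _ (M^T *m n)); lra.
Qed.

(** A dual multiplier n of one solution serves all solutions: v and v' have the
    same objective value, so both subgradient inequalities of v are equalities
    at v', and the affine minorants are exact there too. *)
Lemma primal_KKT v n v' : df v (M^T *m n) -> dg (M *m v) (- n) ->
  argmin setT primal v' -> df v' (M^T *m n) /\ dg (M *m v') (- n).
Proof.
move=> [fv hv] [gv hn] [_ /(_ v I)]; rewrite /primal.
have f0 := cc_ge0 hf v'; have g0 := cc_ge0 hg (M *m v').
move: (hv v') (hn (M *m v')); rewrite -(fineK fv) -(fineK gv).
move: f0 g0; case fv' : (f v') => [a| |]//; case gv' : (g _) => [b| |]// _ _.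
rewrite -!EFinD !lee_fin -mulmxBr (ipNl Em) (ipC Em n) (dot_mulmx M).
rewrite (ipC Ep _ (M^T *m n)) => h1 h2 h3; split; split=> [|y]; rewrite ?fv' ?gv'//.
  apply: le_trans (hv y); rewrite -(fineK fv) -!EFinD lee_fin.
  have -> : y - v = (y - v') + (v' - v) by rewrite addrA subrK.
  by rewrite (ipDr Ep (y - v')); lra.
apply: le_trans (hn y); rewrite -(fineK gv) -!EFinD lee_fin.
have -> : y - M *m v = (y - M *m v') + M *m (v' - v) by rewrite mulmxBr addrA subrK.
rewrite (ipDr Em (y - M *m v')) !(ipNl Em) (ipC Em n (M *m _)) (dot_mulmx M).
by rewrite (ipC Ep _ (M^T *m n)); lra.
Qed.

(** Every primal solution lifts to a fixed point, with the dual part of an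
    arbitrary fixed point. *)
Lemma argmin_primalE : Fix drs !=set0 -> argmin setT primal = Xi M @` Fix drs.
Proof.
case=> u0; have [v [n ->]] := graph_decomposition M u0 => /Fix_drsP[hv hn].
apply/seteqP; split=> [v' hv'|_ [u Fu <-]].
  exists (v' - M^T *m n, M *m v' + n); last exact: Xi_graph.
  by apply/Fix_drsP; exact: primal_KKT hv hn hv'.
move: Fu; have [v1 [n1 ->]] := graph_decomposition M u => /Fix_drsP[h1 h2].
by rewrite Xi_graph; exact: KKT_primal h1 h2.
Qed.

(** The pairing of the subgradients of [drs_resolvent] with the displacement to
    a point of the graph, with a for M^T n, w for M v and (b0, e) for the point
    of the graph. *)
Lemma resolvent_identity (v a b b0 : 'cV[R]_p) (w n c e : 'cV[R]_m) (d : R) :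
  dot a v = dot n w -> dot a b0 = dot n e ->
  dot b v = dot b b + dot a b -> dot c w = dot c c - dot n c ->
  dot (- n - d *: c) (e - (w + d *: c)) + dot (a - d *: b) (b0 - (v + d *: b)) =
  d * (1 + d) * (dot b b + dot c c) - d * (dot b b0 + dot c e).
Proof.
by move=> h1 h2 h3 h4; rewrite !(ipE Ep) !(ipE Em) h1 h2 h3 h4; ring.
Qed.

Variables (Cf K0 K1 : R) (b0 : 'cV[R]_p).
(* [dg_bounded] is a dual coercivity: n is controlled by M^T n along
   subgradients of g, although M^T may have a kernel. *)
Hypothesis f_coercive : forall x, ((enorm x)%:E <= f x)%E.
Hypothesis df_bounded : forall x nu, df x nu -> enorm nu <= Cf.
Hypothesis dg_bounded : forall y nu, dg y nu ->
  enorm nu <= K0 + K1 * enorm (M^T *m nu).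
Hypothesis K1_ge0 : 0 <= K1.
Hypothesis b0_feasible : primal b0 \is a fin_num.

(** The case d = 0 bounds the fixed points, and the cases d > 0 serve to prove
    that there is one. Let x and y be the two prox values. Testing their
    subgradient inequalities at the feasible point (b0, M b0) gives
    f x + g y + d (1 + d) |u|^2 <= const + d <u, d0>, so f x and d |u|^2 are
    bounded uniformly in d, hence x, d u and v = x - d b are. The subgradient nu1
    of f is bounded, and M^T nu2 = - nu1 - d v - d M^T M v, so the dual coercivity
    of g bounds nu2, then n, and finally u. *)
Lemma drs_resolvents_bounded : exists B, forall (d : R) u, 0 <= d <= 1 ->
  drs u = (1 + 2 * d) *: u -> enorm2 u <= B.
Proof.
pose d0 := (b0, M *m b0); pose C := fine (primal b0) + enorm2 d0 ^+ 2 / 2.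
have [kM kM0 hM] := enorm_mulmx_le M.
have [kT kT0 hT] := enorm_mulmx_le M^T.
pose V := 3 * C + 1; pose W := K0 + K1 * (Cf + V + kT * (kM * V)).
exists (V + kT * (W + kM * V) + kM * V + (W + kM * V)) => d u /andP[dge0 dle1].
have [v [n ->]] := graph_decomposition M u.
set b := v - M^T *m n; set c := M *m v + n => /drs_resolvent.
rewrite -/b -/c; set x := v + d *: b; set y := M *m v + d *: c.
set nu1 := _ - d *: b; set nu2 := - n - d *: c => -[hx hy].
have [fx hx'] := hx; have [gy hy'] := hy.
have fx0 := f_coercive x; have gy0 := cc_ge0 hg y.
have orth1 : dot (M^T *m n) v = dot n (M *m v).
  by rewrite (ipC Em n) (dot_mulmx M) (ipC Ep).
have orth2 : dot (M^T *m n) b0 = dot n (M *m b0).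
  by rewrite (ipC Em n) (dot_mulmx M) (ipC Ep).
have bb : dot b v = dot b b + dot (M^T *m n) b.
  by rewrite {3}/b (ipDr Ep) (ipNr Ep) (ipC Ep _ b) subrK.
have cc : dot c (M *m v) = dot c c - dot n c.
  by rewrite {3}/c (ipDr Em) (ipC Em n) addrK.
have id : dot nu2 (M *m b0 - y) + dot nu1 (b0 - x) =
    d * (1 + d) * enorm2 (b, c) ^+ 2 - d * dot2 (b, c) d0.
  by rewrite (nrm_sqr E2); exact: resolvent_identity.
have ud : 2 * dot2 (b, c) d0 <= enorm2 (b, c) ^+ 2 + enorm2 d0 ^+ 2.
  have := sqr_ge0 (nrm (@dot2 R p m) ((b, c) - d0)); rewrite (nrm_sqrB E2) /enorm2.
  rewrite -!/(nrm (@dot2 R p m) _); lra.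
have key : enorm x + d * enorm2 (b, c) ^+ 2 / 2 <= C.
  have := leeD (hy' (M *m b0)) (hx' b0); rewrite -/(primal b0).
  move: fx0 gy0; rewrite -(fineK fx) -(fineK gy) -(fineK b0_feasible) -!EFinD !lee_fin.
  move=> fx0 gy0 h.
  have h1 : d * (2 * dot2 (b, c) d0) <= d * (enorm2 (b, c) ^+ 2 + enorm2 d0 ^+ 2).
    by rewrite ler_wpM2l.
  have h2 : d * enorm2 d0 ^+ 2 <= enorm2 d0 ^+ 2 by rewrite ler_piMl ?sqr_ge0.
  have h3 : 0 <= d ^+ 2 * enorm2 (b, c) ^+ 2 by rewrite mulr_ge0 ?sqr_ge0.
  rewrite /C; lra.
have u0 : 0 <= enorm2 (b, c) by exact: nrm_ge0.
(* (d |u|)^2 <= d |u|^2 <= 2 C <= (2 C + 1)^2 *)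
have du : d * enorm2 (b, c) <= 2 * C + 1.
  have x0 : 0 <= enorm x by exact: nrm_ge0.
  have h1 : (d * enorm2 (b, c)) ^+ 2 <= d * enorm2 (b, c) ^+ 2.
    by rewrite exprMn ler_wpM2r ?sqr_ge0// expr2 ler_piMl.
  have h2 : 0 <= d * enorm2 (b, c) ^+ 2 by rewrite mulr_ge0 ?sqr_ge0.
  rewrite -ler_sqr ?nnegrE ?mulr_ge0//; last by lra.
  have := sqr_ge0 C; lra.
have bu : enorm b <= enorm2 (b, c).
  by rewrite nrm_le_sqr ?nrm_ge0// enorm2_sqr lerDl sqr_ge0.
have vV : enorm v <= V.
  have -> : v = x - d *: b by rewrite /x addrK.
  apply: le_trans (nrmD Ep _ _) _; rewrite (nrmN Ep) (nrmZ Ep) ger0_norm//.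
  have := ler_wpM2l dge0 bu; rewrite -!enormE /V.
  have : 0 <= d * enorm2 (b, c) ^+ 2 by rewrite mulr_ge0 ?sqr_ge0.
  lra.
have wV : enorm (M *m v) <= kM * V.
  by apply: le_trans (hM v) _; rewrite ler_wpM2l.
have wV0 : 0 <= kM * V by apply: le_trans wV; exact: nrm_ge0.
have nu2W : enorm nu2 <= W.
  apply: le_trans (dg_bounded hy) _; rewrite lerD2l ler_wpM2l//.
  have -> : M^T *m nu2 = - nu1 - d *: v - d *: (M^T *m (M *m v)).
    rewrite /nu2 /nu1 /c mulmxBr mulmxN -scalemxAr mulmxDr /b.
    move: (M^T *m n) (M^T *m _) => a a'.
    by apply/matrixP => i k; rewrite !mxE; ring.
  apply: le_trans (nrmD Ep _ _) _; rewrite (nrmN Ep); apply: lerD.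
    apply: le_trans (nrmD Ep _ _) _; rewrite !(nrmN Ep); apply: lerD.
      exact: df_bounded hx.
    rewrite (nrmZ Ep) ger0_norm//; apply: le_trans vV.
    by rewrite ler_piMl// nrm_ge0.
  rewrite (nrmZ Ep) ger0_norm//.
  apply: le_trans (_ : enorm (M^T *m (M *m v)) <= _).
    by rewrite ler_piMl// nrm_ge0.
  by apply: le_trans (hT _) _; rewrite ler_wpM2l.
have nW : enorm n <= W + kM * V.
  apply: le_trans (_ : enorm (- (1 + d) *: n) <= _).
    by rewrite !enormE (nrmZ Em) normrN ger0_norm ?ler_peMl ?nrm_ge0//; lra.
  have -> : - (1 + d) *: n = nu2 + d *: (M *m v).
    rewrite /nu2 /c; move: (M *m v) => w; apply/matrixP => i k; rewrite !mxE; ring.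
  apply: le_trans (nrmD Em _ _) _; apply: lerD => //.
  rewrite (nrmZ Em) ger0_norm//; apply: le_trans wV.
  by rewrite ler_piMl// nrm_ge0.
apply: le_trans (enorm2_le _) _; rewrite /= -[leRHS]addrA; apply: lerD.
  apply: le_trans (nrmD Ep _ _) _; rewrite (nrmN Ep); apply: lerD => //.
  by apply: le_trans (hT _) _; rewrite ler_wpM2l.
by apply: le_trans (nrmD Em _ _) _; apply: lerD.
Qed.

Lemma Fix_drs_bounded : exists B, forall u, Fix drs u -> enorm2 u <= B.
Proof.
have [B hB] := drs_resolvents_bounded; exists B => u Fu.
by apply: (hB 0); rewrite ?lexx ?ler01// mulr0 addr0 scale1r.
Qed.

Lemma Fix_drs_nonempty : Fix drs !=set0.
Proof.
have [B hB] := drs_resolvents_bounded.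
apply: (fixpoint_of_bounded_resolvents E2 drs_nonexpansive (B := B)) => d u /andP[d0 d1].
by apply: hB; rewrite ltW.
Qed.

End DouglasRachford.

(** * The perspective function g *)
Section Perspective.
Variables (R : realType) (q beta : R).
Hypotheses (q_gt1 : 1 < q) (beta_gt0 : 0 < beta).
Let q_gt0 : 0 < q. Proof. exact: lt_trans q_gt1. Qed.
Let q1_gt0 : 0 < q - 1. Proof. by rewrite subr_gt0. Qed.

(** The graph of the q-th power is above its tangent at s: this is Young's
    inequality for r and s^(q-1). *)
Lemma powR_tangent (r s : R) : 0 <= r -> 0 <= s ->
  q * s `^ (q - 1) * r - (q - 1) * s `^ q <= r `^ q.
Proof.
move=> r0 s0; pose q' := q / (q - 1).
have q'0 : 0 < q' by rewrite divr_gt0.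
have := @conjugate_powR _ r (s `^ (q - 1)) q q' r0 (powR_ge0 _ _) q_gt0 q'0.
rewrite -powRrM /q' (mulrC (q - 1)) divfK ?gt_eqF// invf_div.
have -> : q^-1 + (q - 1) / q = 1 by field; rewrite gt_eqF.
move=> /(_ erefl); have := q_gt0; set S := s `^ q; set P := s `^ (q - 1).
set Q := r `^ q => q0 h; have := ler_wpM2l (ltW q0) h.
have -> : q * (Q / q + S * ((q - 1) / q)) = Q + (q - 1) * S.
  by field; rewrite gt_eqF.
lra.
Qed.

Lemma perspective_minorant (t r s : R) : 0 < t -> 0 <= r -> 0 <= s ->
  (q * s `^ (q - 1) * r - t * (q - 1) * s `^ q) / beta <=
  r `^ q / (beta * t `^ (q - 1)).
Proof.
move=> t0 r0 s0; pose w := r / t.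
have w0 : 0 <= w by rewrite divr_ge0// ltW.
have rE : r = w * t by rewrite divfK// gt_eqF.
have P0 : 0 < t `^ (q - 1) by exact: powR_gt0.
rewrite [in leRHS]rE powRM ?(ltW t0)// -(mulr_powRB1 (ltW t0) q_gt0).
have -> : w `^ q * (t * t `^ (q - 1)) / (beta * t `^ (q - 1)) = t * w `^ q / beta.
  by field; rewrite !gt_eqF.
rewrite ler_pM2r ?invr_gt0// rE.
have := ler_wpM2l (ltW t0) (powR_tangent w0 s0); lra.
Qed.

Variables (N p : nat) (z : 'cV[R]_N) (X : 'M[R]_(N, p)) (j : 'I_(p + p)).
Local Notation x := (xvec X j).
Local Notation a := (dot x z).
Local Notation g := (gfun q beta z X j).
Let E := euclidean_dot R N.
Let E1 := euclidean_dot R (1 + N).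

Lemma dot_col_mx m n (c1 d1 : 'cV[R]_m) (c2 d2 : 'cV[R]_n) :
  dot (col_mx c1 c2) (col_mx d1 d2) = dot c1 d1 + dot c2 d2.
Proof. by rewrite -(dot2E (c1, c2) (d1, d2)). Qed.

Lemma dot_const_mx (s t : R) :
  dot (const_mx s : 'cV_1) (const_mx t) = s * t.
Proof. by rewrite dotE big_ord1 !mxE. Qed.

Lemma cV1E (v : 'cV[R]_1) : v = const_mx (v 0 0).
Proof. by apply/matrixP => i k; rewrite !ord1 mxE. Qed.

(** The pair (eta, y) of R x R^N as a vector of R^(1+N). *)
Definition vpair (eta : R) (y : 'cV[R]_N) : 'cV[R]_(1 + N) := col_mx (const_mx eta) y.

Lemma vpairK c : vpair (usubmx c 0 0) (dsubmx c) = c.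
Proof. by rewrite /vpair -cV1E vsubmxK. Qed.

Lemma dot_vpair s t u v : dot (vpair s u) (vpair t v) = s * t + dot u v.
Proof. by rewrite dot_col_mx dot_const_mx. Qed.

Lemma gfun_vpair eta y : g (vpair eta y) =
  if a < eta then (enorm (y - z) `^ q / (beta * (eta - a) `^ (q - 1)))%:E
  else if (y == z) && (eta == a) then 0%E else +oo%E.
Proof. by rewrite /gfun col_mxKu col_mxKd mxE. Qed.

Lemma gfun_ge0 c : (0 <= g c)%E.
Proof.
rewrite -(vpairK c) gfun_vpair; case: ifP => _; last by case: ifP.
by rewrite lee_fin divr_ge0 ?powR_ge0// mulr_ge0 ?powR_ge0// ltW.
Qed.

(** Each slope s >= 0 and direction u in the unit ball give an affine minorant
    of g, homogeneous in (eta - a, y - z): the tangents of the q-th power, seen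
    through the perspective. *)
Lemma gfun_minorant (u : 'cV[R]_N) s eta y : enorm u <= 1 -> 0 <= s ->
  (((q * s `^ (q - 1) * dot u (y - z) - (eta - a) * (q - 1) * s `^ q) / beta)%:E
   <= g (vpair eta y))%E.
Proof.
move=> u1 s0; rewrite gfun_vpair; case: ifPn => [aeta|aeta]; last first.
  case: ifP => [/andP[/eqP -> /eqP ->]|_]; last by rewrite leey.
  by rewrite !subrr (ipC E) (ip0l E) mulr0 !mul0r subrr mul0r.
rewrite lee_fin; apply: le_trans (perspective_minorant _ _ s0); last first.
- exact: nrm_ge0.
- by rewrite subr_gt0.
rewrite ler_pM2r ?invr_gt0// lerB// ler_wpM2l ?mulr_ge0 ?powR_ge0 ?(ltW q_gt0)//.
apply: le_trans (ip_le E _ _) _; rewrite ler_piMl// nrm_ge0//.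
Qed.

Lemma unit_direction (v : 'cV[R]_N) :
  exists2 u, enorm u <= 1 & dot u v = enorm v.
Proof.
have [v0|v0] := eqVneq (enorm v) 0.
  by exists 0; rewrite ?(ip0l E)// enormE (nrm0 E).
exists ((enorm v)^-1 *: v).
  by rewrite enormE (nrmZ E) ger0_norm ?invr_ge0 ?nrm_ge0// mulVf.
by rewrite (ipZl E) -(nrm_sqr E) -enormE expr2 mulKf.
Qed.

(** The minorants of [gfun_minorant] exhaust g. With u the direction of y - z,
    the slope s = |y - z| / (eta - a) is exact inside the domain, s = 0 is
    exact at the apex (a, z), and elsewhere the minorants tend to +oo with s. *)
Lemma gfun_sup_of_affine : sup_of_affine (@dot R (1 + N)) g.
Proof.
move=> c r; rewrite -(vpairK c); set eta := usubmx c 0 0; set y := dsubmx c => rg.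
suff [u [s [u1 s0 h]]] : exists u s, [/\ enorm u <= 1, 0 <= s & r <
    (q * s `^ (q - 1) * dot u (y - z) - (eta - a) * (q - 1) * s `^ q) / beta].
  pose P := q * s `^ (q - 1) / beta; pose S := (q - 1) * s `^ q / beta.
  have key e w : dot (vpair (- S) (P *: u)) (vpair e w) + (S * a - P * dot u z) =
      (q * s `^ (q - 1) * dot u (w - z) - (e - a) * (q - 1) * s `^ q) / beta.
    by rewrite dot_vpair (ipZl E) (ipDr E) (ipNr E) /P /S; field; rewrite gt_eqF.
  exists (vpair (- S) (P *: u)), (S * a - P * dot u z); split=> [d|]; last by rewrite key.
  by rewrite -(vpairK d) key; exact: gfun_minorant.
have [u u1 uv] := unit_direction (y - z).
have n0 : 0 <= enorm (y - z) by exact: nrm_ge0.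
move: rg; rewrite gfun_vpair; case: ifPn => [aeta|].
  have t0 : 0 < eta - a by rewrite subr_gt0.
  pose s := enorm (y - z) / (eta - a).
  have s0 : 0 <= s by rewrite divr_ge0// ltW.
  have sE : enorm (y - z) = s * (eta - a) by rewrite divfK// gt_eqF.
  rewrite lte_fin => rg; exists u, s; split=> //; apply: lt_le_trans rg _.
  rewrite uv sE powRM ?(ltW t0)// -(mulr_powRB1 (ltW t0) q_gt0).
  rewrite -(mulr_powRB1 s0 q_gt0) le_eqVlt; apply/orP; left; apply/eqP.
  have P0 := powR_gt0 (q - 1) t0; have b0 := beta_gt0.
  by field; rewrite !gt_eqF.
rewrite -leNgt => etaa; case: ifPn => [/andP[/eqP yz /eqP ea]|nz _].
  rewrite lte_fin => r0; exists 0, 0; rewrite enormE (nrm0 E) ler01 lexx; split=> //.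
  by rewrite (ip0l E) ea subrr mulr0 !mul0r subrr mul0r.
pose k := q * enorm (y - z) + (q - 1) * (a - eta).
have q1 := q1_gt0; have q0 := q_gt0; have b0 := beta_gt0.
have k0 : 0 < k.
  have ae : 0 <= a - eta by rewrite subr_ge0.
  rewrite /k lt_def addr_ge0 ?mulr_ge0 ?(ltW q0) ?(ltW q1)// andbT.
  rewrite paddr_eq0 ?mulr_ge0 ?(ltW q0) ?(ltW q1)//.
  rewrite !mulf_eq0 (gt_eqF q0) (gt_eqF q1)/=; apply: contra nz => /andP[/eqP h].
  rewrite !subr_eq0 => /eqP ->; rewrite eqxx andbT -subr_eq0.
  by apply/eqP/(nrm_eq0 E).
(* for s >= 1 the minorant is at least k s^(q-1) / beta: take s^(q-1) = L *)
pose L := 1 + (`|r| + 1) * beta / k.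
have L1 : 1 <= L.
  by rewrite lerDl divr_ge0 ?(ltW k0)// mulr_ge0 ?(ltW b0)// addr_ge0.
pose s := L `^ (q - 1)^-1.
have sL : s `^ (q - 1) = L.
  by rewrite -powRrM mulVf ?gt_eqF// powRr1// (le_trans ler01).
have s1 : 1 <= s.
  by rewrite -(powRr0 L) ler_powR// invr_ge0 ltW.
exists u, s; split=> //; first exact: le_trans s1.
rewrite uv -(mulr_powRB1 (le_trans ler01 s1) q_gt0) sL.
rewrite ltr_pdivlMr//.
have Lk : L * k = k + (`|r| + 1) * beta by rewrite /L; field; rewrite gt_eqF.
have h1 : (a - eta) * (q - 1) * L <= (a - eta) * (q - 1) * (s * L).
  rewrite ler_wpM2l ?mulr_ge0 ?subr_ge0//; first by rewrite ltW.
  by rewrite ler_peMl// (le_trans ler01).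
have h2 : r * beta <= `|r| * beta by rewrite ler_wpM2r ?ler_norm// ltW.
have h3 : L * k = q * L * enorm (y - z) + (a - eta) * (q - 1) * L by rewrite /k; ring.
lra.
Qed.

Lemma gfun_closed_convex : nonneg_closed_convex (@dot R (1 + N)) g.
Proof.
split; [exact: gfun_sup_of_affine|exact: gfun_ge0|].
by exists (vpair a z); rewrite gfun_vpair ltxx !eqxx.
Qed.

Lemma gfun_ray t (w : 'cV[R]_N) : 0 < t ->
  g (vpair (a + t) (z + t *: w)) = (t * (enorm w `^ q / beta))%:E.
Proof.
move=> t0; rewrite gfun_vpair ltrDl t0 addrAC subrr add0r addrAC subrr add0r.
rewrite enormE (nrmZ E) (gtr0_norm t0) powRM ?(ltW t0) ?nrm_ge0//.
rewrite -(mulr_powRB1 (ltW t0) q_gt0) -enormE; congr EFin.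
have P0 := powR_gt0 (q - 1) t0; have b0 := beta_gt0.
by field; rewrite !gt_eqF.
Qed.

(** A subgradient of g at any point is dominated by g in every direction from
    the apex (a, z), because g is positively homogeneous there: the
    subgradient inequality along the ray of direction (1, w), divided by
    t -> +oo. *)
Lemma subgrad_gfun_le y mu (nu w : 'cV[R]_N) :
  subgrad (@dot R (1 + N)) g y (vpair mu nu) -> mu + dot nu w <= enorm w `^ q / beta.
Proof.
move=> [fy hy]; set I := mu + _; set K := _ / beta; rewrite leNgt; apply/negP => KI.
pose C := fine (g y) + dot (vpair mu nu) (vpair a z - y).
have hC t : 0 < t -> C + t * I <= t * K.
  move=> t0; have := hy (vpair (a + t) (z + t *: w)); rewrite gfun_ray//.
  rewrite -(fineK fy) -EFinD lee_fin; apply: le_trans.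
  have -> : vpair (a + t) (z + t *: w) = vpair a z + t *: vpair 1 w.
    by rewrite /vpair scale_col_mx add_col_mx; congr col_mx;
      apply/matrixP => i k; rewrite !mxE mulr1.
  by rewrite [_ + _ - y]addrAC (ipDr E1 (_ - y)) (ipZr E1) (dot_vpair mu 1) mulr1 addrA /C.
have IK : 0 < I - K by rewrite subr_gt0.
have tpos : 0 < (`|C| + 1) / (I - K) by rewrite divr_gt0// ltr_wpDl.
have := hC _ tpos.
have : (`|C| + 1) / (I - K) * (I - K) = `|C| + 1 by rewrite divfK// gt_eqF.
set t := _ / _; have := ler_norm (- C); rewrite normrN; lra.
Qed.

Hypothesis colX : forall k : 'I_p, col k X != 0.

Lemma xvec_neq0 : x != 0.
Proof.
rewrite /xvec; case: (split_ordP j) => k ->; first by rewrite colKl colX.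
have -> : col (rshift p k) (row_mx X (- X)) = - col k X.
  by rewrite colKr; apply/matrixP => i l; rewrite !mxE.
by rewrite oppr_eq0 colX.
Qed.

(** The vector e is a basis vector of R^p up to sign. Both the feasibility of
    the problem and the dual coercivity of g rest on x being in the range of X. *)
Lemma xvec_range : exists2 e, enorm e <= 1 & x = X *m e.
Proof.
have unit k : enorm (delta_mx k 0 : 'cV[R]_p) <= 1.
  rewrite /enorm dotE (bigD1 k)//= big1 => [|i ik]; last first.
    by rewrite mxE (negbTE ik) mul0r.
  by rewrite !mxE !eqxx addr0 mulr1 sqrtr1.
rewrite /xvec; case: (split_ordP j) => k ->.
  by exists (delta_mx k 0) => //; rewrite colKl colE.
exists (- delta_mx k 0); first by rewrite enormE (nrmN (euclidean_dot R p)) unit.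
by rewrite colKr colE mulNmx mulmxN.
Qed.

Lemma xvec_norm_gt0 : 0 < enorm x.
Proof.
rewrite lt_def nrm_ge0 andbT; apply/eqP => /(nrm_eq0 E) x0.
by move: xvec_neq0; rewrite x0 eqxx.
Qed.

Lemma Mop_mul b : Mop X j *m b = vpair (dot x (X *m b)) (X *m b).
Proof.
by rewrite /Mop mul_col_mx -mulmxA /vpair [_^T *m _]cV1E.
Qed.

(** Along d = X^T x the first component of M b grows like |d|^2 > 0, so it
    exceeds a; d is nonzero since x = X e is orthogonal to x otherwise. *)
Lemma primal_feasible : exists b,
  primal (Mop X j) (fun b => (norm1 b)%:E) g b \is a fin_num.
Proof.
have [e _ xe] := xvec_range.
pose d := X^T *m x; have d0 : 0 < dot d d.
  rewrite lt_def (ip_ge0 (euclidean_dot R p)) andbT; apply/eqP.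
  move=> /(ip_eq0 (euclidean_dot R p)) dz.
  have : dot x x = 0.
    rewrite {1}xe (dot_mulmx X e) -/d dz (ipC (euclidean_dot R p)).
    exact: (ip0l (euclidean_dot R p)).
  by move=> /(ip_eq0 E) x0; move: xvec_neq0; rewrite x0 eqxx.
exists (((`|a| + 1) / dot d d) *: d); rewrite /primal Mop_mul gfun_vpair.
have -> : dot x (X *m (((`|a| + 1) / dot d d) *: d)) = `|a| + 1.
  rewrite (ipC E) (dot_mulmx X) -/d (ipZl (euclidean_dot R p)) divfK// gt_eqF//.
by have -> : a < `|a| + 1 by rewrite (le_lt_trans (ler_norm _))// ltrDl.
Qed.

(** Write nu = (mu, v) and B = |M^T nu|. The directions (1, 0) and
    (1, (2/|x|) v/|v|) in [subgrad_gfun_le] give mu <= 0 and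
    mu + 2 |v| / |x| <= K. On the other hand
    <x, mu x + v> = <e, M^T nu> >= - B bounds mu below by
    - (B + |x| |v|) / |x|^2. The factor 2 leaves |v| / |x| <= K + B / |x|^2,
    and mu is then bounded as well. *)
Lemma subgrad_gfun_bounded : exists K0, exists2 K1, 0 <= K1 &
  forall y nu, subgrad (@dot R (1 + N)) g y nu ->
    enorm nu <= K0 + K1 * enorm ((Mop X j)^T *m nu).
Proof.
have X0 := xvec_norm_gt0; set n := enorm x in X0.
pose K := (2 / n) `^ q / beta.
have K0 : 0 <= K by rewrite divr_ge0 ?powR_ge0// ltW.
exists (K + n * K), (2 / n ^+ 2 + 1 / n).
  by rewrite addr_ge0// divr_ge0// ?exprn_ge0// ltW.
move=> y nu; rewrite -(vpairK nu); set mu := usubmx _ _ _; set v := dsubmx _ => hnu.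
set B := enorm (_ *m _).
have B0 : 0 <= B by exact: nrm_ge0.
have v0 : 0 <= enorm v by exact: nrm_ge0.
have mu0 : mu <= 0.
  have := subgrad_gfun_le 0 hnu; rewrite (ipC E) (ip0l E) addr0 enormE (nrm0 E).
  by rewrite powR0 ?gt_eqF// mul0r.
have hK : mu + 2 / n * enorm v <= K.
  have [u u1 uv] := unit_direction v.
  have := subgrad_gfun_le ((2 / n) *: u) hnu; rewrite (ipZr E) (ipC E v) uv.
  move/le_trans; apply; rewrite ler_pM2r ?invr_gt0//.
  apply: ge0_ler_powR; rewrite ?nnegrE ?nrm_ge0 ?(ltW q_gt0) ?divr_ge0 ?(ltW X0)//.
  by rewrite enormE (nrmZ E) ger0_norm ?divr_ge0 ?(ltW X0)// ler_piMr ?divr_ge0 ?(ltW X0).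
have hB : - B <= n ^+ 2 * mu + n * enorm v.
  have [e e1 xe] := xvec_range.
  have -> : n ^+ 2 = dot x x by exact: (nrm_sqr E).
  apply: le_trans (_ : dot x (mu *: x + v) <= _); last first.
    by rewrite (ipDr E) (ipZr E) mulrC lerD2l; exact: ip_le.
  have -> : dot x (mu *: x + v) = dot e ((Mop X j)^T *m vpair mu v).
    rewrite {1}xe dot_mulmx; congr dot.
    rewrite /Mop tr_col_mx mul_row_col trmx_mul trmxK -mulmxA -mulmxDr.
    congr (_ *m (_ + _)); apply/matrixP => i k.
    by rewrite ord1 [LHS]mxE [RHS]mxE big_ord1 mulrC; congr (_ * _); rewrite mxE.
  have := ip_abs_le (euclidean_dot R p) e ((Mop X j)^T *m vpair mu v).
  rewrite ler_norml => /andP[h _]; apply: le_trans h; rewrite lerN2.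
  by rewrite ler_piMl.
have vle : n * enorm v <= n ^+ 2 * K + B.
  have := ler_wpM2l (exprn_ge0 2 (ltW X0)) hK.
  have -> : n ^+ 2 * (mu + 2 / n * enorm v) = n ^+ 2 * mu + 2 * (n * enorm v).
    by field; rewrite gt_eqF.
  lra.
have e1 : enorm v <= n * K + B / n.
  rewrite -(ler_pM2l X0); apply: le_trans vle _; rewrite le_eqVlt; apply/orP; left.
  by apply/eqP; field; rewrite gt_eqF.
have e2 : - mu <= K + 2 * B / n ^+ 2.
  have n2 : 0 < n ^+ 2 by rewrite exprn_gt0.
  rewrite -(ler_pM2l n2).
  have -> : n ^+ 2 * (K + 2 * B / n ^+ 2) = n ^+ 2 * K + 2 * B.
    by field; rewrite gt_eqF.
  lra.
have -> : vpair mu v = vpair mu 0 + vpair 0 v.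
  rewrite /vpair add_col_mx; congr col_mx; apply/matrixP => i k.
    by rewrite !mxE addr0.
  by rewrite !mxE add0r.
apply: le_trans (nrmD E1 _ _) _.
have -> : nrm (@dot R (1 + N)) (vpair mu 0) = - mu.
  by rewrite /nrm dot_vpair (ip0l E) addr0 -expr2 sqrtr_sqr ler0_norm.
have -> : nrm (@dot R (1 + N)) (vpair 0 v) = enorm v.
  by rewrite /nrm dot_vpair mul0r add0r.
have -> : K + n * K + (2 / n ^+ 2 + 1 / n) * B =
  (K + 2 * B / n ^+ 2) + (n * K + B / n) by field; rewrite gt_eqF.
exact: lerD.
Qed.

End Perspective.

(** * The smooth objective composed with the projection *)
Section SmoothConvex.
Variables (R : realType) (p : nat) (Psi : 'cV[R]_p -> \bar R).
Variable gradPsi : 'cV[R]_p -> 'cV[R]_p.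
Hypothesis Psi_convex : convex_ereal Psi.
Hypothesis Psi_grad : gateaux_gradient (@dot R p) Psi gradPsi.

(** By convexity, the difference quotients on the segment from x to y are at
    most Psi y - Psi x, and so is their limit on the right at 0. *)
Lemma gradient_inequality x y :
  fine (Psi x) + dot (gradPsi x) (y - x) <= fine (Psi y).
Proof.
have [fin der] := Psi_grad; have [dv dE] := der x (y - x).
rewrite addrC -lerBrDr -dE.
have := cvg_dnbhs_at_right dv => hc.
apply: (cvgr_to_le hc); near=> h.
have h0 : 0 < h by near: h; exact: nbhs_right_gt.
have h1 : h < 1 by near: h; exact: nbhs_right_lt.
have h01 : 0 < h < 1 by rewrite h0.
have := @Psi_convex y x h h01; rewrite /= => hP.
rewrite -[_ *: (_ - _)]/(_ * _) mulrC ler_pdivrMr//.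
have -> : h *: (y - x) + x = h *: y + (1 - h) *: x.
  by rewrite scalerBr scalerBl scale1r addrAC addrA.
rewrite -(fineK (fin x)) -(fineK (fin y)) -(fineK (fin (_ + _))) in hP.
rewrite -!EFinM -EFinD lee_fin in hP; lra.
Unshelve. all: by end_near. Qed.

Variables (m : nat) (M : 'M[R]_(m, p)).

Lemma Xi_convex : convex_ereal (fun u => Psi (Xi M u)).
Proof. by move=> u u' t t01; rewrite XiD !XiZ; exact: Psi_convex. Qed.

(** Xi is linear, so the difference quotients are those of Psi at Xi u in the
    direction Xi v. *)
Lemma Xi_gradient : gateaux_gradient (@dot2 R p m) (fun u => Psi (Xi M u))
  (fun u => Xi_adj M (gradPsi (Xi M u))).
Proof.
have [fin der] := Psi_grad; split=> [u|u v]; first exact: fin.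
have [dv dE] := der (Xi M u) (Xi M v).
have e : (fun h : R => h^-1 *: (((fun y => fine (Psi (Xi M y))) \o shift u) (h *: v)
    - fine (Psi (Xi M u)))) =
  (fun h : R => h^-1 *: (((fun y => fine (Psi y)) \o shift (Xi M u)) (h *: Xi M v)
    - fine (Psi (Xi M u)))).
  by apply/funext => h; rewrite /= XiD XiZ.
by split; [rewrite /derivable e|rewrite /derive e Xi_adjP].
Qed.

Lemma Xi_gradient_inequality u u' :
  fine (Psi (Xi M u)) + dot2 (Xi_adj M (gradPsi (Xi M u))) (u' - u) <=
  fine (Psi (Xi M u')).
Proof. by rewrite Xi_adjP XiB; exact: gradient_inequality. Qed.

Hypothesis Psi_lip : lipschitzian gradPsi.

(** Xi is 1-Lipschitz, hence so is its adjoint: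
    |Xi* w|^2 = <w, Xi (Xi* w)> <= |w| |Xi* w|. *)
Lemma Xi_adj_contraction w : enorm2 (Xi_adj M w) <= enorm w.
Proof.
have E2 := euclidean_dot2 R p m; have Ep := euclidean_dot R p.
have h : enorm2 (Xi_adj M w) ^+ 2 <= enorm w * enorm2 (Xi_adj M w).
  rewrite (nrm_sqr E2) Xi_adjP; apply: le_trans (ip_le Ep _ _) _.
  by apply: ler_wpM2l; [exact: nrm_ge0|exact: Xi_contraction].
have [h0|h0] := eqVneq (enorm2 (Xi_adj M w)) 0; first by rewrite h0 nrm_ge0.
have p0 : 0 < enorm2 (Xi_adj M w) by rewrite lt_def h0 nrm_ge0.
by rewrite expr2 ler_pM2r in h.
Qed.

Lemma Xi_gradient_lipschitz : exists2 L, 0 <= L & forall u u',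
  enorm2 (Xi_adj M (gradPsi (Xi M u)) - Xi_adj M (gradPsi (Xi M u'))) <=
  L * enorm2 (u - u').
Proof.
have [k hk] := Psi_lip; exists `|k| => // u u'.
have -> : Xi_adj M (gradPsi (Xi M u)) - Xi_adj M (gradPsi (Xi M u')) =
    Xi_adj M (gradPsi (Xi M u) - gradPsi (Xi M u')) by rewrite /Xi_adj !mulmxBr.
apply: le_trans (Xi_adj_contraction _) _; apply: le_trans (hk _ _) _.
apply: le_trans (_ : `|k| * enorm (Xi M u - Xi M u') <= _).
  by apply: ler_wpM2r; [exact: nrm_ge0|exact: ler_norm].
by rewrite -XiB; apply: ler_wpM2l => //; exact: Xi_contraction.
Qed.

End SmoothConvex.

(** * Boundedness of the fixed points and convergence of the algorithm *)
Lemma mx_norm_le_enorm (R : realType) n (x : 'cV[R]_n) : `|x| <= enorm x.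
Proof.
rewrite -[leLHS]/(mx_norm x) mx_normrE; apply: bigmax_le; first exact: sqrtr_ge0.
by move=> [i k] _; rewrite /= ord1 entry_le_enorm.
Qed.

Lemma bounded_set_enorm2 (R : realType) m n (A : set ('cV[R]_m * 'cV[R]_n)) B :
  (forall u, A u -> enorm2 u <= B) -> bounded_set A.
Proof.
move=> hB; exists B; split; first exact: num_real.
move=> C BC u /hB uB; apply: le_trans (ltW BC); apply: le_trans uB.
rewrite prod_normE ge_max; apply/andP; split.
  apply: le_trans (mx_norm_le_enorm _) _.
  by rewrite nrm_le_sqr ?nrm_ge0// enorm2_sqr lerDl sqr_ge0.
apply: le_trans (mx_norm_le_enorm _) _.
by rewrite nrm_le_sqr ?nrm_ge0// enorm2_sqr lerDr sqr_ge0.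
Qed.

Theorem theorem28 (R : realType) (N p : nat) (q beta : R) (z : 'cV[R]_N)
    (X : 'M[R]_(N, p)) (Psi : 'cV[R]_p -> \bar R)
    (gradPsi : 'cV[R]_p -> 'cV[R]_p)
    (hq : 1 < q) (hbeta : 0 < beta)
    (hX : forall k : 'I_p, col k X != 0)
    (hPsi : Gamma0 Psi)
    (hgrad : gateaux_gradient (@dot R p) Psi gradPsi)
    (hlip : lipschitzian gradPsi) (j : 'I_(p + p)) :
  let T := T_DRSI q beta z X j in
  let M := Mop X j in
  let K := invmx (1%:M + M *m M^T) in
  bounded_set (Fix T) /\
  Omega q beta z X Psi j !=set0 /\
  forall (alpha : R) (lam : nat -> R),
    0 < alpha < 1 ->
    (@ell2_plus R `\` @ell1_plus R) (fun n => lam n.+1) ->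
    let Ta := fun u => (1 - alpha) *: u + alpha *: T u in
    let Theta := fun u => Psi (Xi M u) in
    nonexpansive Ta /\ convex_ereal Theta /\
    exists2 gradTheta,
      gateaux_gradient (@dot2 R p (1 + N)) Theta gradTheta &
      forall (b bh bs : nat -> 'cV[R]_p) (c ch : nat -> 'cV[R]_(1 + N)),
        (forall n, (bh n, ch n) =
           (1 - alpha) *: (b n, c n) + alpha *: T (b n, c n)) ->
        (forall n, bs n.+1 =
           bh n - M^T *m K *m (M *m bh n - ch n)) ->
        (forall n, b n.+1 =
           bh n - lam n.+1 *: ((1%:M - M^T *m K *m M) *m gradPsi (bs n.+1))) ->
        (forall n, c n.+1 =
           ch n - lam n.+1 *: (K *m M *m gradPsi (bs n.+1))) ->
        hybrid_steepest_descent Ta gradTheta lam (fun n => (b n, c n)) /\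
        dist (Omega q beta z X Psi j) (bs n) @[n --> \oo] --> (0 : R).
Proof.
move=> T M K; have [_ _ Psi_convex] := hPsi.
pose f (b : 'cV[R]_p) := (norm1 b)%:E; pose g := gfun q beta z X j.
have hf : nonneg_closed_convex (@dot R p) f by exact: norm1_closed_convex.
have hg : nonneg_closed_convex (@dot R (1 + N)) g by exact: gfun_closed_convex.
have E2 := euclidean_dot2 R p (1 + N).
have [b0 b0fin] := primal_feasible q beta z j hX.
have [K0 [K1 K1ge0 dgB]] := subgrad_gfun_bounded hq hbeta z j hX.
have fcoer x : ((enorm x)%:E <= f x)%E by rewrite lee_fin enorm_le_norm1.
have dfB := @subgrad_norm1_bounded R p.
have [B FixB] : exists B, forall u, Fix T u -> enorm2 u <= B.
  exact: (Fix_drs_bounded hf hg fcoer dfB dgB K1ge0 b0fin).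
have [w0 Fw0] : Fix T !=set0.
  exact: (Fix_drs_nonempty hf hg fcoer dfB dgB K1ge0 b0fin).
have Tne : nonexpansive T := drs_nonexpansive M hf hg.
have solE : Ssol q beta z X j = Xi M @` Fix T.
  by apply: (argmin_primalE hf hg); exists w0.
pose Th u := fine (Psi (Xi M u)).
pose G u := Xi_adj M (gradPsi (Xi M u)).
have [fin _] := hgrad.
have Gsub : forall u u', Th u + dot2 (G u) (u' - u) <= Th u'.
  exact: Xi_gradient_inequality.
have [L L0 Glip] := Xi_gradient_lipschitz M hlip.
have OmegaXi u : minFix T Th u -> Omega q beta z X Psi j (Xi M u).
  move=> [Fu hu]; rewrite /Omega solE; split; first by exists u.
  by move=> _ [u' Fu' <-]; rewrite -(fineK (fin _)) -(fineK (fin (Xi M u'))) lee_fin hu.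
have mne := minFix_nonempty E2 Tne FixB Fw0 L0 Gsub Glip.
split; first exact: bounded_set_enorm2 FixB.
split; first by case: mne => u /OmegaXi; exists (Xi M u).
move=> alpha lam alpha01 [lam2 lam1] Ta Theta.
split; first by move=> u u'; exact: (averaged_nonexpansive E2 Tne alpha01).
split; first exact: Xi_convex.
exists G; first exact: Xi_gradient.
move=> b bh bs c ch hT hbs hb hc.
have step n : (b n.+1, c n.+1) = Ta (b n, c n) - lam n.+1 *: G (Ta (b n, c n)).
  by rewrite /Ta -hT hb hc hbs.
split; first exact: step.
have bsE n : bs n.+1 = Xi M (Ta (b n, c n)) by rewrite /Ta -hT hbs.
have conv := hsd_convergence E2 Tne alpha01 FixB Fw0 L0 Gsub Glip lam2 lam1
  (z := fun n => (b n, c n)) step.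
apply/cvgrPdist_lt => e e0; have [n0 hn0] := conv e e0.
exists n0.+1 => // -[//|n] /= n0n; rewrite sub0r normrN.
have Om0 : Omega q beta z X Psi j !=set0 by case: mne => u /OmegaXi; exists (Xi M u).
rewrite ger0_norm; last exact: (setdist_ge0 (@dot R p) Om0).
apply: le_lt_trans (hn0 n n0n); apply: le_setdist => // u mu.
apply: le_trans (_ : enorm (bs n.+1 - Xi M u) <= _).
  exact: (setdist_le (@dot R p) _ (OmegaXi _ mu)).
by rewrite bsE -XiB; exact: Xi_contraction.
Qed.
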